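(* Let $r,k$ be positive integers, let $n\ge 2r$ be an integer, let $V_n=\mathbb{C}^n$, let $\boldsymbol{a}\in W_{r,k}$, and let $\mathrm{MP}_{\boldsymbol{a}}(n)=\mathrm{End}_{\mathfrak{S}_n}(\mathcal{P}^{\boldsymbol{a}_1}(V_n)\otimes\cdots\otimes\mathcal{P}^{\boldsymbol{a}_k}(V_n))$. Then, as algebras, $$\mathrm{MP}_{\boldsymbol{a}}(n)\cong\mathrm{End}_{\mathfrak{S}_n}(s_{\boldsymbol{a}}V_n^{\otimes r})\cong s_{\boldsymbol{a}}P_r(n)s_{\boldsymbol{a}},$$ and $s_{\boldsymbol{a}}P_r(n)s_{\boldsymbol{a}}$ is the span, in the painted algebra $\tilde P_{r,k}(n)\cong\mathrm{MP}_{r,k}(n)$, of the diagram-like basis elements $\mathcal{D}_{\tilde\pi}$ for those $\tilde\pi\in\tilde\Pi_{2(r),k}$ whose unbarred and whose barred elements both have multiplicities given by $\boldsymbol{a}$.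
   Context: $W_{r,k}$ is the set of sequences $\boldsymbol{a}=(\boldsymbol{a}_1,\dots,\boldsymbol{a}_k)$ of non-negative integers with sum $r$. $\mathcal{P}^{d}(V_n)$ is the space of homogeneous polynomial functions of degree $d$ on $V_n$; $\mathfrak{S}_n\subseteq GL_n$ (permutation matrices) acts by $(M.f)(v)=f(M^{-1}v)$, and diagonally on tensor products and on $V_n^{\otimes r}$. $[r]=\{1,\dots,r\}$, $[\bar r]=\{\bar1,\dots,\bar r\}$, and $\Pi_{2(r)}$ is the set of set partitions of $[r]\cup[\bar r]$. The partition algebra $P_r(n)$ is the $\mathbb{C}$-algebra with diagram basis $\{\mathcal{L}_\pi:\pi\in\Pi_{2(r)}\}$ and product $\mathcal{L}_\pi\mathcal{L}_\nu=n^{c}\mathcal{L}_\gamma$, where the diagram of $\pi$ (top row $1,\dots,r$, bottom row $\bar1,\dots,\bar r$) is placed above that of $\nu$, identifying bottom vertex $\bar i$ of $\pi$ with top vertex $i$ of $\nu$, $\gamma$ is the resulting connectivity of the very top and very bottom rows, and $c$ is the number of components lying entirely in the middle. For $n\ge2r$, $P_r(n)\cong\mathrm{End}_{\mathfrak{S}_n}(V_n^{\otimes r})$, and $P_r(n)$ acts on $V_n^{\otimes r}$ through this isomorphism, extending the action of $\mathfrak{S}_r$ by permuting tensor factors. $\mathcal{L}_\sigma$ for $\sigma\in\mathfrak{S}_r$ denotes the basis element of $\{\{\sigma(1),\bar1\},\dots,\{\sigma(r),\bar r\}\}$. $\mathfrak{S}_{\boldsymbol{a}}\subseteq\mathfrak{S}_r$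 is the Young subgroup permuting separately the consecutive intervals of lengths $\boldsymbol{a}_1,\dots,\boldsymbol{a}_k$, and $s_{\boldsymbol{a}}=\frac1{|\mathfrak{S}_{\boldsymbol{a}}|}\sum_{\sigma\in\mathfrak{S}_{\boldsymbol{a}}}\mathcal{L}_\sigma$. $\tilde\Pi_{2(r),k}$ is the set of multiset partitions (multisets of nonempty multisets) with $r$ elements from $[k]$ and $r$ elements from $[\bar k]$ in total. $\kappa_{\boldsymbol{a},\boldsymbol{b}}:\Pi_{2(r)}\to\tilde\Pi_{2(r),k}$ replaces each unbarred $i$ by the index $j$ of the consecutive interval of lengths $\boldsymbol{a}_1,\dots,\boldsymbol{a}_k$ containing $i$, and each $\bar i$ by $\bar j$ with $j$ the index of the interval of lengths $\boldsymbol{b}_1,\dots,\boldsymbol{b}_k$ containing $i$. The painted algebra is the external direct sum $\tilde P_{r,k}(n)=\bigoplus_{\boldsymbol{a},\boldsymbol{b}\in W_{r,k}}s_{\boldsymbol{a}}P_r(n)s_{\boldsymbol{b}}$ with $(s_{\boldsymbol{a}}\varphi s_{\boldsymbol{b}})\cdot(s_{\boldsymbol{c}}\psi s_{\boldsymbol{d}})=\delta_{\boldsymbol{b},\boldsymbol{c}}s_{\boldsymbol{a}}\varphi s_{\boldsymbol{b}}\psi s_{\boldsymbol{d}}$; for $n\ge 2r$ it is isomorphic to $\mathrm{MP}_{r,k}(n)=\mathrm{End}_{\mathfrak{S}_n}(\mathcal{P}^r(V_{n,k}))$, where $V_{n,k}$ is the space of $n\times k$ matrices. If $\tilde\pi\in\tilde\Pi_{2(r),k}$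 has unbarred/barred multiplicities $\boldsymbol{a}$/$\boldsymbol{b}$, then $\mathcal{D}_{\tilde\pi}=s_{\boldsymbol{a}}\mathcal{L}_\pi s_{\boldsymbol{b}}$ for any $\pi$ with $\kappa_{\boldsymbol{a},\boldsymbol{b}}(\pi)=\tilde\pi$. *)

(* Defs.v *)
From HB Require Import structures.
From mathcomp Require Import all_boot all_order all_fingroup all_algebra.
From mathcomp Require Import finmap multiset.
From mathcomp Require Import boolp classical_sets functions.

Set Implicit Arguments.
Unset Strict Implicit.
Unset Printing Implicit Defensive.

Import GRing.Theory Num.Theory.

Local Open Scope ring_scope.

(* Algebras whose underlying space is a subspace [carrier] of a
   finite-dimensional space. The product is only meaningful on [carrier], and
   [aone] is the unit of [carrier] (e.g. the idempotent s for s A s). *)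
Record subAlgebra (K : fieldType) := SubAlgebra {
  ambient : vectType K;
  carrier : set ambient;
  amul : ambient -> ambient -> ambient;
  aone : ambient }.
Arguments carrier {K} s _.
Arguments amul {K s} x y : rename.
Arguments aone {K} s.

(* A linear map between subspaces always extends to the ambient spaces, so
   asking for f on the ambient space is no restriction. *)
Definition alg_iso (K : fieldType) (A B : subAlgebra K) : Prop :=
  exists f : {linear ambient A -> ambient B},
    [/\ set_bij (carrier A) (carrier B) f,
        (forall x y, carrier A x -> carrier A y ->
           f (amul x y) = amul (f x) (f y))
      & f (aone A) = aone B].

(* End_{S_n}(T), for S_n acting on T through rho *)
Definition EndS (K : fieldType) (n : nat) (T : vectType K)
    (rho : 'S_n -> T -> T) : subAlgebra K :=
  {| ambient := 'End(T);
     carrier := [set f : 'End(T) | forall s x, f (rho s x) = rho s (f x)]%classic;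
     amul := fun f g => (f \o g)%VF;
     aone := \1%VF |}.

Definition lspan (K : fieldType) (V : vectType K) (S : set V) : set V :=
  [set x | exists2 s : seq V, (forall y, y \in s -> S y) & x \in <<s>>%VS]%classic.

Definition lfree (K : fieldType) (V : vectType K) (I : eqType) (S : set I)
    (v : I -> V) : Prop :=
  forall s : seq I, uniq s -> (forall i, i \in s -> S i) -> free (map v s).

Section PolynomialFunctions.
Variables (K : numFieldType) (n m d : nat).

Definition mono := {e : {ffun 'I_n * 'I_m -> 'I_d.+1} | (\sum_x e x == d)%N}.

Definition mono_fun (e : mono) (v : 'M[K]_(n, m)) : K :=
  \prod_x v x.1 x.2 ^+ val e x.

Definition is_hpoly (f : 'M[K]_(n, m) -> K) : Prop :=
  exists c : mono -> K, forall v, f v = \sum_e c e * mono_fun e v.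

Definition hpoly : {pred ('M[K]_(n, m) -> K^o)} := fun f => `[< is_hpoly f >].

(* P^d of the space of n x m matrices; V_n is the case m = 1 *)
Record polyfun := PolyFun {
  polyfun_val :> 'M[K]_(n, m) -> K^o;
  _ : polyfun_val \in hpoly }.

HB.instance Definition _ := [isSub for polyfun_val].
HB.instance Definition _ := [Choice of polyfun by <:].

Lemma hpoly_submod_closed : submod_closed hpoly.
Proof.
split; first by apply/asboolP; exists (fun=> 0) => v; rewrite big1 // => e; rewrite mul0r.
move=> a f g /asboolP[c Hf] /asboolP[c' Hg]; apply/asboolP.
exists (fun e => a * c e + c' e) => v.
rewrite [LHS](_ : _ = a * f v + g v) // Hf Hg mulr_sumr -big_split /=.
by apply: eq_bigr => e _; rewrite mulrDl mulrA.
Qed.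

HB.instance Definition _ :=
  GRing.isSubmodClosed.Build K ('M[K]_(n, m) -> K^o) hpoly hpoly_submod_closed.
HB.instance Definition _ := [SubChoice_isSubLmodule of polyfun by <:].

Lemma expansion_inj (B N : nat) (a b : 'I_N -> 'I_B) :
  (\sum_(i < N) a i * B ^ i = \sum_(i < N) b i * B ^ i)%N -> a =1 b.
Proof.
elim: N a b => [|N IH] a b; first by move=> _ [].
have E (c : 'I_N.+1 -> 'I_B) : (\sum_(i < N.+1) c i * B ^ i =
   (\sum_(i < N) c (lift ord0 i) * B ^ i) * B + c ord0)%N.
  rewrite big_ord_recl /= expn0 muln1 addnC; congr addn.
  by rewrite big_distrl /=; apply: eq_bigr => i _; rewrite expnSr mulnA.
rewrite !E => H.
have B0 : (0 < B)%N by case: (a ord0) => x /=; case: (B).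
have H0 : a ord0 = b ord0.
  apply: val_inj => /=; have := congr1 (modn^~ B) H.
  by rewrite /= !modnMDl !modn_small.
have H1 : (\sum_(i < N) a (lift ord0 i) * B ^ i =
           \sum_(i < N) b (lift ord0 i) * B ^ i)%N.
  by apply/eqP; move/eqP: H; rewrite H0 eqn_add2r eqn_pmul2r.
move=> i; case: (unliftP ord0 i) => [j|] -> //.
exact: (IH (fun i => a (lift ord0 i)) (fun i => b (lift ord0 i)) H1).
Qed.

Lemma mono_free (c : mono -> K) :
  (forall v, \sum_e c e * mono_fun e v = 0) -> forall e, c e = 0.
Proof.
move=> H0.
pose code (e : mono) := (\sum_(i < #|{: 'I_n * 'I_m}|)
   val e (enum_val i) * d.+1 ^ i)%N.
have code_inj : injective code.
  move=> e e' /(expansion_inj (a := fun i => val e (enum_val i)))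
    /(_ _) H; apply: val_inj; apply/ffunP => x.
  by have := H (enum_rank x); rewrite enum_rankK.
pose p : {poly K} := \sum_e c e *: 'X^(code e).
have p_code e : p`_(code e) = c e.
  rewrite /p coef_sum (bigD1 e) //= coefZ coefXn eqxx mulr1 big1 ?addr0 //.
  move=> e' ne; rewrite coefZ coefXn eq_sym (inj_eq code_inj) (negbTE ne).
  by rewrite mulr0.
suff p0 : p = 0 by move=> e; rewrite -p_code p0 coef0.
have pt t : p.[t] = 0.
  rewrite -(H0 (\matrix_(i, j) t ^+ (d.+1 ^ enum_rank (i, j)))).
  rewrite /p horner_sum; apply: eq_bigr => e _.
  rewrite hornerZ hornerXn /mono_fun /code; congr (_ * _).
  rewrite [RHS](reindex (@enum_val _ predT)) /=; last first.
    by apply: onW_bij; exact: enum_val_bij.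
  rewrite -prodrXr; apply: eq_bigr => i _.
  by rewrite mxE -surjective_pairing enum_valK -exprM mulnC.
apply/eqP/negPn/negP => pN0.
pose rs : seq K := [seq i%:R | i <- iota 0 (size p)].
have rs_root : all (root p) rs by apply/allP => x _; rewrite /root pt.
have rs_uniq : uniq rs.
  by rewrite map_inj_uniq ?iota_uniq // => i j /eqP; rewrite eqr_nat => /eqP.
by have := max_poly_roots pN0 rs_root rs_uniq; rewrite size_map size_iota ltnn.
Qed.

Lemma hpoly_of_coefP (c : 'rV[K]_(#|{: mono}|)) :
  (fun v => \sum_e c 0 (enum_rank e) * mono_fun e v : K^o) \in hpoly.
Proof. by apply/asboolP; exists (fun e => c 0 (enum_rank e)). Qed.

Definition hpoly_of_coef c := PolyFun (hpoly_of_coefP c).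

Lemma hpoly_of_coef_linear : linear hpoly_of_coef.
Proof.
move=> a c c'; apply: val_inj; apply/funext => v /=.
rewrite [RHS](_ : _ = a * (\sum_e c 0 (enum_rank e) * mono_fun e v) +
  \sum_e c' 0 (enum_rank e) * mono_fun e v) //.
rewrite mulr_sumr -big_split /=.
by apply: eq_bigr => e _; rewrite !mxE mulrDl mulrA.
Qed.

Lemma hpoly_of_coef_bij : bijective hpoly_of_coef.
Proof.
rewrite -setTT_bijective; split => //.
- move=> c c' _ _ H; apply/rowP => i.
  apply/eqP; rewrite -subr_eq0; apply/eqP; rewrite -(enum_valK i).
  move: (enum_val i); apply: (@mono_free
    (fun e => c 0 (enum_rank e) - c' 0 (enum_rank e))) => v.
  under eq_bigr do rewrite mulrBl.
  by rewrite sumrB; move/(congr1 (fun f => polyfun_val f v)): H => /= ->; rewrite subrr.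
- move=> [f fP] _; have /asboolP[c Hc] := fP.
  exists (\row_i c (enum_val i)) => //; apply: val_inj; apply/funext => v /=.
  by rewrite Hc; apply: eq_bigr => e _; rewrite mxE enum_rankK.
Qed.

Lemma polyfun_vect_axiom : Vector.axiom #|{: mono}| polyfun.
Proof.
have [g gK Kg] : {g | cancel hpoly_of_coef g & cancel g hpoly_of_coef}.
  by apply: cid2; case: hpoly_of_coef_bij => g; exists g.
exists g; last by exists hpoly_of_coef.
move=> a f h; apply: (can_inj gK); rewrite hpoly_of_coef_linear.
by rewrite !Kg.
Qed.

HB.instance Definition _ := Lmodule_hasFinDim.Build K polyfun polyfun_vect_axiom.

Lemma polyact_subproof (s : 'S_n) (f : polyfun) :
  (fun v => f (invmx (perm_mx s) *m v) : K^o) \in hpoly.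
Proof.
case: f => f /asboolP[c Hf] /=; apply/asboolP.
pose trf (t : 'S_n) (e : mono) : {ffun 'I_n * 'I_m -> 'I_d.+1} :=
  [ffun x => val e (t x.1, x.2)].
have trP t e : (\sum_x trf t e x == d)%N.
  apply/eqP; transitivity (\sum_x val e x)%N; last exact: eqP (valP e).
  rewrite [RHS](reindex (fun x => (t x.1, x.2))) /=.
    by apply: eq_bigr => x _; rewrite ffunE.
  by exists (fun x => ((t^-1)%g x.1, x.2)) => -[i j] _ /=; rewrite ?permK ?permKV.
pose tr t e : mono := Sub (trf t e) (trP t e).
have trK : cancel (tr s) (tr s^-1%g).
  by move=> e; apply: val_inj; apply/ffunP => -[i j]; rewrite !ffunE /= permKV.
have trKV : cancel (tr s^-1%g) (tr s).
  by move=> e; apply: val_inj; apply/ffunP => -[i j]; rewrite !ffunE /= permK.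
exists (fun e => c (tr s^-1%g e)) => v; rewrite Hf.
rewrite [RHS](reindex (tr s)) /=; last by exists (tr s^-1%g) => e _.
apply: eq_bigr => e _; rewrite trK; congr (_ * _); rewrite /mono_fun.
have -> : invmx (perm_mx s) = perm_mx s^-1%g :> 'M[K]_n.
  have U : perm_mx s \in unitmx := unitmx_perm K s.
  by apply: (can_inj (mulKmx U)); rewrite mulmxV // -perm_mxM mulgV perm_mx1.
rewrite [LHS](reindex (fun x => (s x.1, x.2))) /=; last first.
  by exists (fun x => ((s^-1)%g x.1, x.2)) => -[i j] _ /=; rewrite ?permK ?permKV.
apply: eq_bigr => -[i j] _; rewrite -row_permE !mxE !ffunE /=.
by rewrite permK.
Qed.

(* (M.f)(v) = f(M^{-1} v) for the permutation matrix M of s *)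
Definition polyact (s : 'S_n) (f : polyfun) : polyfun :=
  PolyFun (polyact_subproof s f).

End PolynomialFunctions.
Arguments polyfun : clear implicits.

(* The tensor product of a finite family of finite-dimensional spaces, in
   coordinates: t J is the coordinate of t on the tensor product over i of the
   (J i)-th vectors of the bases vbasis {: U i}. *)
Section TensorProduct.
Variables (K : fieldType) (k : nat) (U : 'I_k -> vectType K).

Definition tindex : finType := fprod (fun i => 'I_(\dim {: U i})).

Definition tensor : vectType K := {ffun tindex -> K^o}.

Definition tpure (u : forall i, U i) : tensor :=
  [ffun J : tindex => \prod_i coord (vbasis {: U i}) (J i) (u i)].

(* the tensor product of the linear maps f i *)
Definition tmap (f : forall i, U i -> U i) (t : tensor) : tensor :=
  \sum_(J : tindex) t J *: tpure (fun i => f i (vbasis {: U i})`_(J i)).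

Lemma tmap_pure (f : forall i, {linear U i -> U i}) (u : forall i, U i) :
  tmap (fun i => f i) (tpure u) = tpure (fun i => f i (u i)).
Proof.
apply/ffunP => L; rewrite /tmap sum_ffunE ffunE.
pose F i := [ffun j : 'I_(\dim {: U i}) => coord (vbasis {: U i}) j (u i) *
   coord (vbasis {: U i}) (L i) (f i (vbasis {: U i})`_j)].
transitivity (\sum_(J : tindex) \prod_(i in 'I_k) F i (J i)).
  apply: eq_bigr => J _; rewrite !ffunE -[LHS]/(_ * _) -big_split /=.
  by apply: eq_bigr => i _; rewrite ffunE.
rewrite (big_fprod _ _ F) -(bigA_distr_big_dep _ (fun i => untag 0 (F i))) /=.
apply: eq_bigr => i _; rewrite -(big_tag (fun i => F i)) /=.
rewrite [in RHS](coord_vbasis (memvf (u i))) !linear_sum /=.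
by apply: eq_bigr => j _; rewrite ffunE !linearZ.
Qed.

End TensorProduct.

Section Diagrams.
Variable r : nat.

(* inl i is the vertex i of the top row, inr i the vertex \bar i below it *)
Definition vert : finType := ('I_r + 'I_r)%type.

Definition diag := {P : {set {set vert}} | finset.partition P [set: vert]}.

Definition perm_diag_set (s : 'S_r) : {set {set vert}} :=
  [set [set inl (s i); inr i] | i : 'I_r].

Lemma perm_diag_subproof s : finset.partition (perm_diag_set s) [set: vert].
Proof.
apply/and3P; split.
- apply/eqP/setP => x; rewrite inE; apply/bigcupP; case: x => i.
    exists [set inl i; inr (s^-1 i)%g]; rewrite ?inE ?eqxx //.
    by apply/imsetP; exists (s^-1 i)%g; rewrite ?permKV.
  exists [set inl (s i); inr i]; rewrite ?inE ?eqxx ?orbT //.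
  by apply/imsetP; exists i.
- apply/finset.trivIsetP => _ _ /imsetP[i _ ->] /imsetP[j _ ->] ne.
  have nij : i != j by apply: contraNneq ne => ->.
  rewrite -setI_eq0; apply/eqP/setP => -[] x; rewrite !inE /= ?orbF.
    apply/negbTE/negP => /andP[/eqP[->] /eqP[/perm_inj/eqP]].
    by rewrite (negbTE nij).
  by apply/negbTE/negP => /andP[/eqP[->] /eqP[/eqP]]; rewrite (negbTE nij).
- by apply/negP => /imsetP[i _ /setP/(_ (inr i))]; rewrite !inE eqxx orbT.
Qed.

(* {{s(1), \bar 1}, ..., {s(r), \bar r}} *)
Definition perm_diag (s : 'S_r) : diag :=
  Sub (perm_diag_set s) (perm_diag_subproof s).

(* Stacking p above q: the three rows are inl i (top), inr (inl i) (middle, the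
   bottom row of p glued to the top row of q) and inr (inr i) (bottom). *)
Definition vert3 : finType := ('I_r + vert)%type.
Definition upper (x : vert) : vert3 :=
  match x with inl i => inl i | inr i => inr (inl i) end.
Definition lower (x : vert) : vert3 := inr x.
Definition outer (x : vert) : vert3 :=
  match x with inl i => inl i | inr i => inr (inr i) end.
Definition middle : {set vert3} := [set inr (inl i) | i : 'I_r].

Definition stack_edge (p q : diag) : rel vert3 := fun u v =>
  [exists B in val p, (u \in upper @: B) && (v \in upper @: B)]
  || [exists B in val q, (u \in lower @: B) && (v \in lower @: B)].

Lemma stack_edge_sym p q : connect_sym (stack_edge p q).
Proof.
apply: sym_connect_sym => u v; congr (_ || _);
  by apply/eq_existsb => B; rewrite [in LHS](andbC (u \in _)).
Qed.

Definition stack_set (p q : diag) : {set {set vert}} := equivalence_partition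
  (fun x y => connect (stack_edge p q) (outer x) (outer y)) [set: vert].

Lemma stack_subproof p q : finset.partition (stack_set p q) [set: vert].
Proof.
apply: equivalence_partitionP => x y z _ _ _; split; first exact: connect0.
by move/(same_connect (@stack_edge_sym p q)).
Qed.

Definition stack (p q : diag) : diag :=
  Sub (stack_set p q) (stack_subproof p q).

(* the number of components of the stacked diagram inside the middle row *)
Definition middle_comps (p q : diag) : nat :=
  #|[set C in equivalence_partition (connect (stack_edge p q)) [set: vert3]
     | C \subset middle]|.

End Diagrams.

(* inl j is the colour j, inr j the colour \bar j *)
Definition colour (k : nat) : choiceType := ('I_k + 'I_k)%type.

(* multisets of multisets of colours *)
Definition mspartition (k : nat) : choiceType := {mset {mset colour k}}%mset.

Section Compositions.
Variables (r k : nat).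

(* W_{r,k}; the parts are at most r since they sum up to r *)
Definition W := {a : k.-tuple 'I_r.+1 | sumn (map val a) == r}.

Definition parts (a : W) : seq nat := map val (val a).
Definition part (a : W) (j : 'I_k) : nat := tnth (val a) j.

Lemma interval_subproof (a : W) (i : 'I_r) : (reshape_index (parts a) i < k)%N.
Proof.
have H : size (parts a) = k by rewrite size_map size_tuple.
by rewrite -[X in (_ < X)%N]H; apply: reshape_indexP; rewrite (eqP (valP a)).
Qed.

(* index of the interval containing i, among the consecutive intervals of [r]
   of lengths a_1, ..., a_k *)
Definition interval (a : W) (i : 'I_r) : 'I_k := Ordinal (interval_subproof a i).

Definition young (a : W) : {set 'S_r} :=
  [set s : 'S_r | [forall i, interval a (s i) == interval a i]].

Local Open Scope mset_scope.

Definition unbarred (p : mspartition k) (j : 'I_k) : nat :=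
  (\sum_(B <- enum_mset p) B (inl j))%N.
Definition barred (p : mspartition k) (j : 'I_k) : nat :=
  (\sum_(B <- enum_mset p) B (inr j))%N.

(* \tilde\Pi_{2(r),k} *)
Definition msPi : set (mspartition k) :=
  [set p : mspartition k | [/\ mset0 \notin enum_mset p, (\sum_j unbarred p j = r)%N
             & (\sum_j barred p j = r)%N]]%classic.

Definition has_mult (p : mspartition k) (a b : W) : Prop :=
  (forall j, unbarred p j = part a j) /\ (forall j, barred p j = part b j).

Definition paint (a b : W) (x : vert r) : colour k :=
  match x with inl i => inl (interval a i) | inr i => inr (interval b i) end.

Definition kappa (a b : W) (p : diag r) : mspartition k :=
  seq_mset [seq seq_mset [seq paint a b x | x <- enum B]
            | B : {set vert r} <- enum (val p)].

End Compositions.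

Section PartitionAlgebra.
Variables (K : numFieldType) (r n : nat).

(* the partition algebra P_r(n): only its product depends on n *)
Definition palg : vectType K := {ffun diag r -> K^o}.

Definition L (p : diag r) : palg := [ffun q => (q == p)%:R].

Definition pmul (x y : palg) : palg :=
  \sum_p \sum_q (x p * y q * n%:R ^+ middle_comps p q) *: L (stack p q).

(* V_n^{\otimes r}: t i is the coordinate on e_{i_1} \otimes ... \otimes e_{i_r} *)
Definition tpow : vectType K := {ffun {ffun 'I_r -> 'I_n} -> K^o}.

(* M (v_1 \otimes ... \otimes v_r) = M v_1 \otimes ... \otimes M v_r *)
Definition tpow_mx (M : 'M[K]_n) (t : tpow) : tpow :=
  [ffun i : {ffun 'I_r -> 'I_n} =>
     \sum_(j : {ffun 'I_r -> 'I_n}) (\prod_l M (i l) (j l)) * t j].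

(* the labelling of the vertices by i on top and j below is constant on the
   blocks of p *)
Definition compatible (p : diag r) (i j : {ffun 'I_r -> 'I_n}) : bool :=
  let lab x := match x with inl l => i l | inr l => j l end in
  [forall B in val p, forall x in B, forall y in B, lab x == lab y].

(* L_p maps e_j to the sum of the e_i such that (i, j) is compatible with p *)
Definition pact (x : palg) (t : tpow) : tpow :=
  [ffun i : {ffun 'I_r -> 'I_n} =>
     \sum_p x p * \sum_(j | compatible p i j) t j].

Lemma pact_linear x : linear (pact x).
Proof.
move=> c t u; apply/ffunP => i; rewrite [RHS]ffunE [X in _ = X + _]ffunE.
rewrite -[_ *: _ in RHS]/(_ * _) !ffunE mulr_sumr -big_split /=; apply: eq_bigr => p _.
rewrite mulrCA -mulrDr; congr (_ * _); rewrite mulr_sumr -big_split /=.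
by apply: eq_bigr => j _; rewrite !ffunE.
Qed.

HB.instance Definition _ x :=
  GRing.isLinear.Build K tpow tpow _ (pact x) (pact_linear x).

Lemma tpow_permE (s : 'S_n) t i :
  tpow_mx (perm_mx s) t i = t [ffun l => s (i l)].
Proof.
rewrite ffunE (bigD1 [ffun l => s (i l)]) //= big1 => [|l _]; last first.
  by rewrite ffunE !mxE eqxx.
rewrite mul1r big1 ?addr0 // => j ne.
have [l ne_l] : exists l, s (i l) != j l.
  apply/existsP; apply: contraR ne => /existsPn H; apply/eqP/ffunP => l.
  by rewrite ffunE; apply/esym/eqP; have := H l; rewrite negbK.
by rewrite (bigD1 l) //= !mxE (negbTE ne_l) !mul0r.
Qed.

Lemma pact_perm (s : 'S_n) x t :
  pact x (tpow_mx (perm_mx s) t) = tpow_mx (perm_mx s) (pact x t).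
Proof.
apply/ffunP => i; rewrite tpow_permE !ffunE; apply: eq_bigr => p _.
congr (_ * _).
pose tr (u : 'S_n) (j : {ffun 'I_r -> 'I_n}) := [ffun l => u (j l)].
rewrite [RHS](reindex (tr s)) /=; last first.
  by exists (tr s^-1%g) => j _; apply/ffunP => l; rewrite !ffunE ?permK ?permKV.
apply: eq_big => [j|j _]; last by rewrite tpow_permE.
rewrite /compatible; apply: eq_forallb => B; congr (_ ==> _).
apply: eq_forallb => x0; congr (_ ==> _).
apply: eq_forallb => y0; congr (_ ==> _).
by case: x0 y0 => l [] l'; rewrite ?ffunE (inj_eq perm_inj).
Qed.

Variable k : nat.
Implicit Types a b : W r k.

Definition sym a : palg :=
  #|young a|%:R^-1 *: \sum_(s in young a) L (perm_diag s).

(* s_a V_n^{\otimes r} *)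
Definition sV a : {vspace tpow} := limg (linfun (pact (sym a))).

Lemma sV_perm a (s : 'S_n) (t : subvs_of (sV a)) :
  tpow_mx (perm_mx s) (vsval t) \in sV a.
Proof.
have /memv_imgP[u _ ->] := subvsP t.
by rewrite lfunE /= -pact_perm; apply/memv_imgP; exists (tpow_mx (perm_mx s) u);
  rewrite ?memvf // lfunE.
Qed.

(* tpow_mx (perm_mx s) restricted to s_a V_n^{\otimes r}, see sV_perm *)
Definition sV_act a (s : 'S_n) (t : subvs_of (sV a)) : subvs_of (sV a) :=
  vsproj (sV a) (tpow_mx (perm_mx s) (vsval t)).

Definition EndsV a : subAlgebra K := EndS (@sV_act a).

(* s_a P_r(n) s_b *)
Definition corner a b : set palg :=
  [set pmul (pmul (sym a) x) (sym b) | x in [set: palg]]%classic.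

Definition corner_alg a : subAlgebra K :=
  {| ambient := palg; carrier := corner a a; amul := pmul; aone := sym a |}.

(* The (a, b) component of an element of the external direct sum of the
   s_a P_r(n) s_b is its value at (a, b). *)
Definition painted_space : vectType K := {ffun W r k * W r k -> palg}.

Definition painted : set painted_space :=
  [set x | forall a b, corner a b (x (a, b))]%classic.

Definition painted_inj a b (y : palg) : painted_space :=
  [ffun ab => if ab == (a, b) then y else 0].

Definition painted_mul (x y : painted_space) : painted_space :=
  \sum_a \sum_b \sum_c \sum_d
    if b == c then painted_inj a d (pmul (x (a, b)) (y (c, d))) else 0.

Definition painted_one : painted_space := \sum_a painted_inj a a (sym a).

Definition painted_alg : subAlgebra K :=
  {| ambient := painted_space; carrier := painted;
     amul := painted_mul; aone := painted_one |}.

(* If kappa a b p = pt then a and b are the multiplicities of the unbarred and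
   barred elements of pt, so that at most one summand is nonzero. *)
Definition D (pt : mspartition k) : painted_space :=
  \sum_a \sum_b
    if [pick p | kappa a b p == pt] is Some p
    then painted_inj a b (pmul (pmul (sym a) (L p)) (sym b)) else 0.

(* End_{S_n}(P^{a_1}(V_n) \otimes ... \otimes P^{a_k}(V_n)) *)
Definition MPa a : subAlgebra K :=
  EndS (fun s : 'S_n =>
    @tmap K k (fun j => polyfun K n 1 (part a j))
      (fun j => @polyact K n 1 (part a j) s)).

(* End_{S_n}(P^r(V_{n,k})) *)
Definition MP : subAlgebra K := EndS (@polyact K n k r).

End PartitionAlgebra.

(* Main.v *)
(** For n >= 2r the partition algebra is faithful on V_n^{(x) r}, with image the
    S_n-equivariant operators: the matrix entry of an operator at a pair of words
    (i, j) is a labelling of the 2r vertices, equivariance says that it only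
    depends on the partition of the vertices into level sets, every partition
    occurs because n >= 2r, and L_p contributes exactly where p refines that
    partition, so that passing from coefficients to matrix entries is a
    unitriangular change of basis.  Products of diagrams, corners and units can
    thus all be compared as operators, s_a being the average over the Young
    subgroup of a.

    A polynomial, or a tensor of polynomials, is determined by the function that
    sends a word i of length r to its coefficient at the monomial prod_l x_(i_l)
    in the variables of the block of l.  Two words give the same monomial iff the
    Young subgroup exchanges them, so this function is a vector fixed by s_a, and
    every such vector arises: P^{a_1} (x) ... (x) P^{a_k} is S_n-isomorphic to
    s_a V_n^{(x) r}, and P^r(V_{n,k}) to the sum of these spaces over a. *)
Require Import Defs.
From HB Require Import structures.
From mathcomp Require Import all_boot all_order all_fingroup all_algebra.
From mathcomp Require Import finmap multiset.
From mathcomp Require Import boolp classical_sets functions reals.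
From mathcomp Require Import complex.
Import Defs.

Set Implicit Arguments.
Unset Strict Implicit.
Unset Printing Implicit Defensive.

Import GRing.Theory Num.Theory.

Local Open Scope ring_scope.

(** * Functions on finite sets with prescribed fibre sizes *)

Lemma card_fiber_tnth (T : eqType) (N : nat) (t : N.-tuple T) (y : T) :
  #|[set i | tnth t i == y]| = count_mem y t.
Proof.
rewrite -[in RHS](map_tnth_enum t) count_map cardE size_filter /=.
by rewrite enumT; apply: eq_count => i; rewrite /= inE.
Qed.

Lemma card_fiber_map (A : finType) (T : eqType) (f : A -> T) (y : T) :
  #|[set x | f x == y]| = count_mem y [seq f x | x <- enum A].
Proof.
by rewrite count_map cardE size_filter /= enumT; apply: eq_count => i; rewrite /= inE.
Qed.

(** Listed along an enumeration of [A], the two families of values are permutations of each other;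
    the permutation of positions is then carried back to [A]. *)
Lemma perm_of_eq_fibers (A : finType) (T : eqType) (f g : A -> T) :
  (forall y, #|[set x | f x == y]| = #|[set x | g x == y]|) ->
  exists s : {perm A}, forall x, f x = g (s x).
Proof.
move=> fg.
have sz (h : A -> T) : size [seq h x | x <- enum A] == #|A| by rewrite size_map -cardE.
pose t h : #|A|.-tuple T := Tuple (sz h).
have /tuple_permP[s Es] : perm_eq (t f) (t g).
  by apply/allP => y _ /=; rewrite -!card_fiber_map fg.
have Et h i : tnth (t h) i = h (enum_val i).
  by rewrite (tnth_nth (h (enum_val i))) /= (nth_map (enum_val i)) -?cardE // /enum_val;
    congr h; apply: set_nth_default; rewrite -cardE.
have inj : injective (fun x => enum_val (s (enum_rank x))).
  by move=> x y /enum_val_inj/perm_inj/enum_rank_inj.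
exists (perm inj) => x; rewrite permE -Et.
have -> : f x = tnth (t f) (enum_rank x) by rewrite Et enum_rankK.
have -> : t f = [tuple tnth (t g) (s i) | i < #|A|] by apply: val_inj.
by rewrite tnth_mktuple.
Qed.

(** The list containing each pair [(b, c)] exactly [m b c] times has the same first components as
    [f], with multiplicity. A permutation aligns the two, and [g] reads off the second
    components. *)
Lemma exists_fiber_split (A B C : finType) (f : A -> B) (m : B -> C -> nat) :
  (forall b, \sum_c m b c = #|[set x | f x == b]|)%N ->
  exists g : A -> C,
    forall b c, #|[set x | (f x == b) && (g x == c)]| = m b c.
Proof.
move=> fm.
pose s := flatten [seq nseq (m bc.1 bc.2) bc | bc <- enum {: B * C}].
have cs bc : count_mem bc s = m bc.1 bc.2.
  rewrite count_flatten -map_comp sumnE big_map big_enum /= (bigD1 bc) //=.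
  rewrite count_nseq /= eqxx mul1n big1 ?addn0 // => bc' /negbTE ne.
  by rewrite count_nseq /= ne.
have cs1 b : count (fun bc => bc.1 == b) s = #|[set x | f x == b]|.
  rewrite count_flatten -map_comp sumnE big_map big_enum /=.
  transitivity (\sum_b1 \sum_c count (fun bc => bc.1 == b) (nseq (m b1 c) (b1, c)))%N.
    by rewrite pair_bigA; apply: eq_bigr => -[].
  rewrite -fm.
  rewrite (bigD1 b) //= [X in (_ + X)%N]big1 ?addn0 => [|b' ne].
    by apply: eq_bigr => c _; rewrite count_nseq /= eqxx mul1n.
  by apply: big1 => c _; rewrite count_nseq /= (negbTE ne).
have szs : size s == #|A|.
  rewrite -(count_predT s).
  have -> : (count predT s = \sum_b count (fun bc => bc.1 == b) s)%N.
    elim: s {cs cs1} => [|bc s IH] /=; first by rewrite big1.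
    rewrite big_split /= IH -big_mkcond /=.
    by congr (_ + _)%N; rewrite (big_pred1 bc.1).
  apply/eqP; rewrite -sum1_card (partition_big f predT) //=.
  apply: eq_bigr => b _; rewrite cs1 -sum1_card.
  by apply: eq_bigl => x; rewrite inE.
pose t := Tuple szs.
have [p Ep] : exists p : 'S_#|A|, forall i, f (enum_val i) = (tnth t (p i)).1.
  apply: (@perm_of_eq_fibers _ _ (fun i => f (enum_val i)) (fun i => (tnth t i).1)) => b.
  have -> : #|[set i | (tnth t i).1 == b]| = count (fun bc => bc.1 == b) s.
    transitivity (count (fun bc => bc.1 == b) t) => //.
    rewrite -[in RHS](map_tnth_enum t) count_map cardE size_filter /=.
    by rewrite enumT; apply: eq_count => i; rewrite /= inE.
  rewrite cs1 -(card_imset _ (@enum_val_inj _ predT)); apply: eq_card => x.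
  rewrite inE; apply/imsetP/idP => [[u] /[!inE] ? -> //|fx].
  by exists (enum_rank x); rewrite ?inE enum_rankK.
exists (fun x => (tnth t (p (enum_rank x))).2) => b c.
rewrite -(cs (b, c)).
rewrite -[RHS](card_fiber_tnth t (b, c)).
have inj : injective (fun x : A => p (enum_rank x)).
  by move=> x y /perm_inj/enum_rank_inj.
rewrite -(card_imset _ inj); apply: eq_card => i.
rewrite [RHS]inE; apply/imsetP/idP => [[x] /[!inE] /andP[fx gx] ->|ti].
  by move: fx; rewrite -{1}(enum_rankK x) Ep; case: (tnth t _) gx => u v /= /eqP-> /eqP->.
exists (enum_val (p^-1%g i)); rewrite ?enum_valK ?permKV //.
by rewrite inE Ep enum_valK permKV (eqP ti) !eqxx.
Qed.

(** * Intervals of a composition *)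

Lemma reshape_index_cons x sh i : reshape_index (x :: sh) i =
  if (i < x)%N then 0%N else (reshape_index sh (i - x)).+1.
Proof.
rewrite /reshape_index /= subn_eq0; case: ltnP => // xi.
by rewrite subSn.
Qed.

(** Induction on the composition: the first [x] indices lie in block 0, and the later ones are those
    of the tail with index shifted by [x] and block by one. *)
Lemma count_reshape_index sh j :
  count (fun i => reshape_index sh i == j) (iota 0 (sumn sh)) = nth 0%N sh j.
Proof.
elim: sh j => [|x sh IH] j /=; first by rewrite nth_nil.
rewrite iotaD count_cat add0n.
have -> : count (fun i => reshape_index (x :: sh) i == j) (iota 0 x) =
    if j == 0%N then x else 0%N.
  transitivity (count (fun i => (0 == j)%N) (iota 0 x)).
    apply: eq_in_count => i; rewrite mem_iota => /= ix.
    by rewrite reshape_index_cons ix.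
  rewrite eq_sym; case: (j == 0%N); first by rewrite count_predT size_iota.
  by rewrite count_pred0.
have -> : iota x (sumn sh) = [seq x + i | i <- iota 0 (sumn sh)]%N.
  by rewrite -iotaDl addn0.
rewrite count_map.
have -> : count (preim (addn x) (fun i => reshape_index (x :: sh) i == j))
   (iota 0 (sumn sh)) = count (fun i => (reshape_index sh i).+1 == j) (iota 0 (sumn sh)).
  by apply: eq_count => i /=; rewrite reshape_index_cons ltnNge leq_addr /= addKn.
case: j => [|j] /=; last by rewrite -IH; apply: eq_count => i.
by rewrite (eq_count (a2 := pred0)) ?count_pred0 ?addn0.
Qed.

Lemma card_interval r k (a : W r k) (j : 'I_k) :
  #|[set l | interval a l == j]| = part a j.
Proof.
have := count_reshape_index (parts a) j.
rewrite (eqP (valP a)) /part (tnth_nth ord0) /parts (nth_map ord0) ?size_tuple //.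
move=> <-; rewrite -val_enum_ord count_map cardE size_filter -enumT.
by apply: eq_count => l; rewrite /= inE.
Qed.

Lemma W_ext r k (a b : W r k) : (forall j, part a j = part b j) -> a = b.
Proof. by move=> ab; apply/val_inj/eq_from_tnth => j; apply: val_inj; exact: ab. Qed.

Lemma W_exists r k (m : 'I_k -> nat) : (\sum_j m j = r)%N ->
  exists a : W r k, forall j, part a j = m j.
Proof.
move=> mr.
have mS j : (m j < r.+1)%N by rewrite ltnS -mr (bigD1 j) //= leq_addr.
have tP : sumn (map val [tuple Ordinal (mS j) | j < k]) == r.
  by rewrite sumnE big_map big_tuple /=; under eq_bigr do rewrite tnth_mktuple; apply/eqP.
by exists (Sub [tuple Ordinal (mS j) | j < k] tP) => j; rewrite /part /= tnth_mktuple.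
Qed.

(** * The relation of a diagram and the stacking product *)
Section DiagramRelation.
Variable r : nat.
Implicit Types p q : diag r.

(** By [diag_rel_inj] this relation determines the diagram, so equalities of diagrams are checked on
    pairs of vertices. *)
Definition diag_rel p : rel (vert r) := fun x y => y \in finset.pblock (val p) x.

Lemma diag_cover p x : x \in finset.cover (val p).
Proof. by rewrite (cover_partition (valP p)) inE. Qed.

Lemma diag_relE p x y : diag_rel p x y = (finset.pblock (val p) x == finset.pblock (val p) y).
Proof. by rewrite /diag_rel eq_pblock ?diag_cover //; case/and3P: (valP p). Qed.

Lemma diag_relP p x y :
  reflect (exists2 B, B \in val p & x \in B /\ y \in B) (diag_rel p x y).
Proof.
apply: (iffP idP) => [xy|[B Bp [xB yB]]].
  exists (finset.pblock (val p) x); first by apply: pblock_mem; exact: diag_cover.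
  by rewrite mem_pblock diag_cover.
have tI : finset.trivIset (val p) by case/and3P: (valP p).
by rewrite /diag_rel (def_pblock tI Bp xB).
Qed.

Lemma diag_rel_inj p q : diag_rel p =2 diag_rel q -> p = q.
Proof.
move=> pq; apply: val_inj.
rewrite -(equivalence_partition_pblock (valP p)) -(equivalence_partition_pblock (valP q)).
by apply: eq_imset => x; apply/setP => y; rewrite !inE; congr (_ && _); exact: pq.
Qed.

(** Level sets of [g]. Every diagram has this form, for labels in ['I_n] by [exists_labelling] and
    for numbered blocks by [exists_block_index]. *)
Definition ker_diag (T : eqType) (g : vert r -> T) : diag r :=
  Sub (preim_partition g [set: vert r]) (preim_partitionP g [set: vert r]).

Lemma ker_diagE (T : eqType) (g : vert r -> T) x y :
  diag_rel (ker_diag g) x y = (g x == g y).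
Proof.
rewrite /diag_rel /= /preim_partition pblock_equivalence_partition ?inE //.
by move=> u v w _ _ _; split=> // /eqP->.
Qed.

Lemma stackE p q x y :
  diag_rel (stack p q) x y = connect (stack_edge p q) (outer x) (outer y).
Proof.
rewrite /diag_rel /= pblock_equivalence_partition ?inE //.
move=> u v w _ _ _; split; first exact: connect0.
by move/(same_connect (@stack_edge_sym _ p q)).
Qed.

Definition diag_le p q := [forall x, forall y, diag_rel p x y ==> diag_rel q x y].

Lemma diag_leP p q : reflect (subrel (diag_rel p) (diag_rel q)) (diag_le p q).
Proof.
apply: (iffP forallP) => [H x y|H x]; first by have /forallP/(_ y)/implyP := H x.
by apply/forallP => y; apply/implyP/H.
Qed.

(** Turns refinement into inclusion of finite sets, so that its cardinality is strictly increasing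
    for [diag_le]. *)
Definition diag_pairs p := [set u | diag_rel p u.1 u.2].

Lemma diag_leE p q : diag_le p q = (diag_pairs p \subset diag_pairs q).
Proof.
apply/diag_leP/fintype.subsetP => [H [x y]|H x y]; first by rewrite !inE; exact: H.
by have := H (x, y); rewrite !inE.
Qed.

Lemma diag_pairs_inj : injective diag_pairs.
Proof.
by move=> p q pq; apply: diag_rel_inj => x y; move/setP/(_ (x, y)): pq; rewrite !inE.
Qed.

Variable n : nat.
Notation word := {ffun 'I_r -> 'I_n}.

Definition lab (i j : word) (x : vert r) : 'I_n :=
  match x with inl l => i l | inr l => j l end.

Lemma compatibleP p (i j : word) :
  reflect (forall x y, diag_rel p x y -> lab i j x = lab i j y) (compatible p i j).
Proof.
apply: (iffP 'forall_implyP) => [H x y /diag_relP[B Bp [xB yB]]|H B Bp].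
  by have /'forall_implyP/(_ x xB)/'forall_implyP/(_ y yB)/eqP := H B Bp.
apply/'forall_implyP => x xB; apply/'forall_implyP => y yB; apply/eqP/H.
by apply/diag_relP; exists B.
Qed.

Lemma compatibleE p (i j : word) : compatible p i j = diag_le p (ker_diag (lab i j)).
Proof.
by apply/compatibleP/diag_leP => H x y => [/H e|/H]; rewrite ker_diagE ?e // => /eqP.
Qed.

Lemma ker_diag_lab (g : vert r -> 'I_n) :
  ker_diag (lab [ffun l => g (inl l)] [ffun l => g (inr l)]) = ker_diag g.
Proof.
by apply: diag_rel_inj => -[x|x] [y|y]; rewrite !ker_diagE /= !ffunE.
Qed.

Definition lab3 (i m j : word) (u : vert3 r) : 'I_n :=
  match u with inl l => i l | inr x => lab m j x end.

Lemma lab3_upper i m j x : lab3 i m j (upper x) = lab i m x. Proof. by case: x. Qed.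
Lemma lab3_lower i m j x : lab3 i m j (lower x) = lab m j x. Proof. by []. Qed.
Lemma lab3_outer i m j x : lab3 i m j (outer x) = lab i j x. Proof. by case: x. Qed.

(** Both compatibilities together say that the labelling of the three rows is constant along the
    edges of the stacked diagram, hence on its components. *)
Lemma compatible2P p q i m j :
  reflect (forall u v, connect (stack_edge p q) u v -> lab3 i m j u = lab3 i m j v)
    (compatible p i m && compatible q m j).
Proof.
apply: (iffP andP) => [[/compatibleP cp /compatibleP cq] u v|H].
  case/connectP => s; elim: s u => [|w s IH] u /= => [_ -> //|/andP[uw ws] vE].
  rewrite -(IH w) //; case/orP: uw => /'exists_andP[B [Bp /andP[]]].
    case/imsetP => x xB -> /imsetP[y yB ->]; rewrite !lab3_upper; apply: cp.
    by apply/diag_relP; exists B.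
  case/imsetP => x xB -> /imsetP[y yB ->]; rewrite !lab3_lower; apply: cq.
  by apply/diag_relP; exists B.
split; apply/compatibleP => x y /diag_relP[B Bp [xB yB]].
  rewrite -!(lab3_upper i m j); apply/H/connect1/orP; left.
  by apply/'exists_andP; exists B; split=> //; rewrite !imset_f.
rewrite -!(lab3_lower i m j); apply/H/connect1/orP; right.
by apply/'exists_andP; exists B; split=> //; rewrite !imset_f.
Qed.


(* A compatible labelling of the middle row is forced on the components meeting
   the outer rows, and free and constant on each component inside the middle. *)
Lemma card_middle_labellings p q (i j : word) : (0 < n)%N ->
  #|[set m : word | compatible p i m && compatible q m j]| =
  (if compatible (stack p q) i j then n ^ middle_comps p q else 0)%N.
Proof.
move=> n0; pose d := Ordinal n0; pose e := connect (stack_edge p q).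
have e_sym : symmetric e by exact: (@stack_edge_sym _ p q).
have etr : transitive e by exact: connect_trans.
case: ifPn => [/compatibleP cst|ncst]; last first.
  apply/eqP; rewrite cards_eq0 -finset.subset0; apply/fintype.subsetP => m; rewrite !inE => cm.
  case/negP: ncst; apply/compatibleP => x y; rewrite stackE => xy.
  by rewrite -!(lab3_outer i m j); move/compatible2P: cm; apply.
have lab_eq x y : e (outer x) (outer y) -> lab i j x = lab i j y.
  by move=> xy; apply: cst; rewrite stackE.
pose cls u := [set v in [set: vert3 r] | e u v].
pose MC := [set C in equivalence_partition e [set: vert3 r] | C \subset middle r].
have cls_eq u v : e u v -> cls u = cls v.
  move=> uv; apply/setP => w; rewrite !inE /=.
  by apply/idP/idP; apply: etr; rewrite // e_sym.
have in_cls u v : (v \in cls u) = e u v by rewrite !inE.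
have clsMC u : (cls u \in MC) = (cls u \subset middle r).
  by rewrite inE andb_idl // => _; apply/imsetP; exists u; rewrite ?inE.
have MCcls C : C \in MC -> exists u, C = cls (inr (inl u)).
  move=> CMC; have: C \in MC by []; rewrite inE => /andP[/imsetP[u _ CE] /fintype.subsetP Cm].
  have /imsetP[l _ uE] : u \in middle r by apply: Cm; rewrite CE in_cls /e connect0.
  by exists l; rewrite CE uE.
(* The label forced by an outer vertex of the component of [u]. The default [d] arises only on
   components inside the middle row, where [h] uses [phi] instead. *)
pose ext u := if [pick x | e u (outer x)] is Some x then lab i j x else d.
pose h (phi : {ffun {C | C \in MC} -> 'I_n}) u :=
  if insub (cls u) is Some C then phi C else ext u.
have h_eq phi u v : e u v -> h phi u = h phi v.
  move=> uv; rewrite /h (cls_eq u v uv); case: insub => //.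
  rewrite /ext; have /eq_pick-> // : (fun x => e u (outer x)) =1 (fun x => e v (outer x)).
  by move=> x; apply/idP/idP; apply: etr; rewrite // e_sym.
have outerN x : cls (outer x) \notin MC.
  rewrite clsMC; apply/subsetPn; exists (outer x); first by rewrite in_cls /e connect0.
  by case: x => x; apply/imsetP => -[].
have h_outer phi x : h phi (outer x) = lab i j x.
  rewrite /h insubN // /ext; case: pickP => [y xy|/(_ x)]; last by rewrite /e connect0.
  by apply/esym/lab_eq.
pose g phi : word := [ffun l => h phi (inr (inl l))].
have lab3_g phi u : lab3 i (g phi) j u = h phi u.
  case: u => [l|[l|l]] /=; last 1 first.
  - by rewrite -[RHS]/(h phi (outer (inr l))) h_outer.
  - by rewrite -[RHS]/(h phi (outer (inl l))) h_outer.
  - by rewrite ffunE.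
have g_inj : injective g.
  move=> phi psi gE; apply/ffunP => -[C CMC]; have [l CE] := MCcls C CMC.
  have /ffunP/(_ l) := gE; rewrite !ffunE /h -CE insubT //.
rewrite /middle_comps -/MC -(card_sig (mem MC)) -[in RHS](card_ord n) -card_ffun.
rewrite -cardsT -(card_imset _ g_inj); apply: eq_card => m; rewrite inE.
apply/idP/imsetP => [/compatible2P cm|[phi _ ->]]; last first.
  by apply/compatible2P => u v uv; rewrite !lab3_g; exact: h_eq.
(* The preimage of [m] under [g] records, for each middle component, the label at any of its
   vertices; components are nonempty, so [d] is not reached. *)
exists [ffun C : {C | C \in MC} => if [pick u in val C] is Some u then lab3 i m j u else d] => //.
apply/ffunP => l; rewrite ffunE /h; case: insubP => [C _ CE|].
  rewrite ffunE CE; case: pickP => [u|/(_ (inr (inl l)))]; rewrite in_cls.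
    by move/cm => <-.
  by rewrite /e connect0.
rewrite clsMC => /subsetPn[u]; rewrite in_cls => lu um; rewrite /ext.
have [x uE] : exists x, u = outer x.
  case: u um {lu} => [a|[a|a]]; first by exists (inl a).
    by rewrite imset_f ?inE.
  by exists (inr a).
case: pickP => [y /cm|/(_ x)]; first by rewrite lab3_outer => <-.
by rewrite -uE lu.
Qed.

End DiagramRelation.

(** * The action of the partition algebra on tensor powers *)
Lemma ffun_scaleE (K : fieldType) (A : finType) (c : K) (f : {ffun A -> K^o}) a :
  (c *: f) a = c * f a.
Proof. by rewrite ffunE. Qed.

Lemma ffun_delta_sum (K : fieldType) (A : finType) (f : {ffun A -> K^o}) :
  f = \sum_a f a *: ([ffun b => (b == a)%:R] : {ffun A -> K^o}).
Proof.
apply/ffunP => b; rewrite sum_ffunE (bigD1 b) //= [X in _ + X]big1 => [|a /negbTE ab].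
  by rewrite ffun_scaleE ffunE eqxx mulr1 addr0.
by rewrite ffun_scaleE ffunE eq_sym ab mulr0.
Qed.

(** Identities in the partition algebra are checked on these operators: [pop_mul] turns products
    into compositions and [pop_inj] gives back the equality. *)
HB.lock Definition palg_op (K : numFieldType) (r n : nat) (x : palg K r) :
  'End(tpow K r n) := linfun (pact x).

Section PartitionAlgebraAction.
Variables (K : numFieldType) (r n : nat).
Implicit Types (p q : diag r) (x y : palg K r).
Notation word := {ffun 'I_r -> 'I_n}.
Notation tp := (tpow K r n).

Notation pop := (@palg_op K r n).

Lemma popE x t : pop x t = pact x t.
Proof. by rewrite palg_op.unlock lfunE. Qed.

Lemma pop_linear : linear pop.
Proof.
move=> c x y; apply/lfunP => t; rewrite add_lfunE scale_lfunE !popE.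
apply/ffunP => i; rewrite /pact !ffunE -[RHS]/(c * _ + _) mulr_sumr -big_split /=; apply: eq_bigr => p _.
by rewrite !ffunE mulrDl -[_ *: _]/(_ * _) mulrA.
Qed.
HB.instance Definition _ := GRing.isLinear.Build K (palg K r) 'End(tp) _ pop pop_linear.

Lemma popL p t i : pop (L K p) t i = \sum_(j | compatible p i j) t j.
Proof.
rewrite popE ffunE (bigD1 p) //= ffunE eqxx mul1r [X in _ + X]big1 ?addr0 // => q /negbTE qp.
by rewrite ffunE qp mul0r.
Qed.

Lemma palg_sumE x : x = \sum_p x p *: L K p.
Proof. exact: ffun_delta_sum. Qed.

Definition tbasis (j : word) : tp := [ffun i => (i == j)%:R].

Lemma tpow_sumE (t : tp) : t = \sum_j t j *: tbasis j.
Proof. exact: ffun_delta_sum. Qed.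

Lemma pop_sumE x t : pop x t = \sum_p x p *: pop (L K p) t.
Proof.
rewrite {1}(palg_sumE x) linear_sum sum_lfunE; apply: eq_bigr => p _.
by rewrite linearZ scale_lfunE.
Qed.

Lemma popL_tbasis p i j : pop (L K p) (tbasis j) i = (compatible p i j)%:R.
Proof.
rewrite popL big_mkcond (bigD1 j) //= ffunE eqxx big1 ?addr0 => [|k /negbTE kj].
  by case: ifP.
by rewrite ffunE kj if_same.
Qed.

Lemma pop_tbasis x i j : pop x (tbasis j) i = \sum_(p | compatible p i j) x p.
Proof.
rewrite pop_sumE sum_ffunE [RHS]big_mkcond /=.
apply: eq_bigr => p _; rewrite ffun_scaleE popL_tbasis.
by case: ifP; rewrite ?mulr1 ?mulr0.
Qed.

Hypothesis n_gt0 : (0 < n)%N.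

(** The coefficient of [t j] in the [i]-th coordinate counts the middle words compatible with both
    diagrams, which [card_middle_labellings] evaluates. *)
Lemma popL_comp p q : (pop (L K p) \o pop (L K q))%VF =
  n%:R ^+ middle_comps p q *: pop (L K (stack p q)).
Proof.
apply/lfunP => t; rewrite comp_lfunE scale_lfunE; apply/ffunP => i.
rewrite [RHS]ffun_scaleE.
rewrite popL [X in _ = _ * X]popL.
transitivity (\sum_(m | compatible p i m) \sum_(j | compatible q m j) t j).
  by apply: eq_bigr => m _; rewrite popL.
rewrite (exchange_big_dep predT) //= [X in _ * X]big_mkcond mulr_sumr /=.
apply: eq_bigr => j _; rewrite sumr_const.
have := card_middle_labellings p q i j n_gt0; rewrite cardsE => ->.
by case: ifP => _; rewrite ?mulr0 // -natrX mulr_natl.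
Qed.

Lemma pop_mul x y : pop (pmul n x y) = (pop x \o pop y)%VF.
Proof.
apply/lfunP => t; rewrite comp_lfunE (pop_sumE x) (pop_sumE y) /pmul linear_sum sum_lfunE.
apply: eq_bigr => p _; rewrite linear_sum sum_lfunE linear_sum scaler_sumr.
apply: eq_bigr => q _; rewrite 2!linearZ /= -(comp_lfunE (pop (L K p))) popL_comp.
by rewrite !scale_lfunE !scalerA.
Qed.

Hypothesis n_ge2r : (2 * r <= n)%N.

Lemma exists_labelling q : exists g : vert r -> 'I_n, ker_diag g = q.
Proof.
have le : (#|{: vert r}| <= n)%N by rewrite card_sum card_ord addnn -mul2n.
(* The picked vertex depends only on the block of [x], since the predicate does; it serves as a
   canonical representative. *)
pose rep (x : vert r) := odflt x [pick y | diag_rel q x y].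
have repE (x y : vert r) : (rep x == rep y) = diag_rel q x y.
  have xr (z : vert r) : diag_rel q z (rep z).
    by rewrite /rep; case: pickP => //= /(_ z); rewrite !diag_relE eqxx.
  apply/eqP/idP => [e|xy].
    move: (xr x); rewrite e !diag_relE => /eqP->; have := xr y.
    by rewrite diag_relE eq_sym.
  rewrite /rep; have /eq_pick-> : diag_rel q x =1 diag_rel q y.
    by move=> z; move: xy; rewrite !diag_relE => /eqP->.
  by case: pickP => //= /(_ y); rewrite !diag_relE eqxx.
exists (fun x : vert r => widen_ord le (enum_rank (rep x))); apply: diag_rel_inj => x y.
rewrite ker_diagE -repE -(inj_eq enum_rank_inj).
by apply/eqP/eqP => [[/val_inj]|->].
Qed.

(** The zeta transform of the refinement order, which passes from the coefficients of [x] to the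
    matrix entries of its operator, see [zeta_ker]. *)
Definition zeta x : palg K r := [ffun q => \sum_(p | diag_le p q) x p].

Lemma zeta_linear : linear zeta.
Proof.
move=> c x y; apply/ffunP => q; rewrite !ffunE -[RHS]/(c * _ + _) mulr_sumr -big_split /=.
by apply: eq_bigr => p _; rewrite !ffunE.
Qed.
HB.instance Definition _ := GRing.isLinear.Build K (palg K r) (palg K r) _ zeta zeta_linear.

(** Among the diagrams with nonzero coefficient, take one with the fewest related pairs: no proper
    refinement contributes, so the transform there equals that coefficient. *)
Lemma zeta_inj : injective zeta.
Proof.
apply: raddf_inj => x z0; apply/eqP/negPn/negP => xN0.
have [p0 p0N] : exists p, x p != 0.
  by apply/existsP; apply: contraR xN0 => /existsPn H; apply/eqP/ffunP => p;
    rewrite ffunE; apply/eqP/negPn.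
case: (arg_minnP (P := fun p => x p != 0) (fun p => #|diag_pairs p|) p0N) => q qN qmin.
have /ffunP/(_ q) := z0; rewrite !ffunE (bigD1 q) /=; last exact/diag_leP.
rewrite big1 ?addr0 => [/eqP|p /andP[le ne]]; first by rewrite (negbTE qN).
apply/eqP/negPn/negP => /qmin; rewrite leqNgt proper_card // finset.properEneq -diag_leE le andbT.
by rewrite (inj_eq (@diag_pairs_inj _)).
Qed.

Lemma zeta_surj y : exists x, zeta x = y.
Proof.
have ker0 : lker (linfun zeta) == 0%VS by apply/lker0P => u v; rewrite !lfunE; exact: zeta_inj.
by exists ((linfun zeta)^-1%VF y); rewrite -[LHS](lfunE zeta) lker0_lfunVK.
Qed.

Lemma zeta_ker x (g : vert r -> 'I_n) :
  zeta x (ker_diag g) = pop x (tbasis [ffun l => g (inr l)]) [ffun l => g (inl l)].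
Proof.
by rewrite ffunE pop_tbasis; apply: eq_bigl => p; rewrite compatibleE ker_diag_lab.
Qed.

Lemma pop_inj : injective pop.
Proof.
move=> x y xy; apply: zeta_inj; apply/ffunP => q.
by have [g <-] := exists_labelling q; rewrite !zeta_ker xy.
Qed.

Definition equivariant (f : 'End(tp)) :=
  forall (s : 'S_n) t, f (tpow_mx (perm_mx s) t) = tpow_mx (perm_mx s) (f t).

Lemma pop_equivariant x : equivariant (pop x).
Proof. by move=> s t; rewrite !popE pact_perm. Qed.

(* Both g and h tag each value they take with the same vertex, picked in its
   level set; a permutation respecting the tags sends g to h. *)
Lemma eq_ker_perm (g h : vert r -> 'I_n) : ker_diag g = ker_diag h ->
  exists s : 'S_n, forall x : vert r, h x = s (g x).
Proof.
move=> gh; have E (x y : vert r) : (g x == g y) = (h x == h y) by rewrite -!ker_diagE gh.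
pose F (f : vert r -> 'I_n) (z : 'I_n) := [pick x | f x == z].
(* The tag [Some x] occurs once if [x] represents its own level set, and never otherwise. *)
have fib f (x : vert r) : #|[set z | F f z == Some x]| = (F f (f x) == Some x).
  case: eqP => [e|ne].
    rewrite -[RHS]/1%N -(cards1 (f x)); apply: eq_card => z; rewrite !inE.
    apply/eqP/eqP => [|-> //]; rewrite /F; case: pickP => // y /eqP yz [yx].
    by rewrite -yz yx.
  apply/eqP; rewrite cards_eq0; apply/eqP/setP => z; rewrite !inE; apply/negP => /eqP e.
  case: ne; have zf : f x = z by move: e; rewrite /F; case: pickP => // y /eqP yz [yx]; rewrite -yz yx.
  by rewrite zf.
have Fgh (x : vert r) : F g (g x) = F h (h x) by apply: eq_pick => y; exact: E.
(* Values outside the image carry the tag [None]. Since all tags together number [n], equality for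
   the tags [Some x] forces equality for [None]. *)
have tot f : (#|[set z | F f z == None]| + \sum_x #|[set z | F f z == Some x]|)%N = n.
  transitivity (\sum_(z < n) 1)%N; last by rewrite sum1_card card_ord.
  rewrite [RHS](partition_big (F f) predT) //= [RHS](bigD1 None) //= (reindex_omap Some id) /=; last by case.
  congr (_ + _)%N; last apply: eq_big => [x|x _]; rewrite ?eqxx //;
    by rewrite -sum1_card; apply: eq_bigl => z; rewrite !inE.
have sumE : (\sum_x #|[set z | F g z == Some x]| = \sum_x #|[set z | F h z == Some x]|)%N.
  by apply: eq_bigr => x _; rewrite !fib Fgh.
have [|s sE] := @perm_of_eq_fibers _ _ (F g) (F h).
  case=> [x|]; first by rewrite !fib Fgh.
  by apply/eqP; rewrite -(eqn_add2r (\sum_x #|[set z | F g z == Some x]|)) tot sumE tot.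
exists s => x; have := sE (g x); rewrite Fgh /F.
case: pickP => [y /eqP yx|/(_ x)]; last by rewrite eqxx.
by case: pickP => // z /eqP zE [yz]; rewrite -yx -zE yz.
Qed.

Lemma tpow_perm_tbasis (s : 'S_n) (j : word) :
  tpow_mx (perm_mx s) (tbasis [ffun l => s (j l)]) = tbasis j.
Proof.
apply/ffunP => i; rewrite tpow_permE !ffunE; congr ((nat_of_bool _)%:R).
by apply/eqP/eqP => [/ffunP H|->//]; apply/ffunP => l; have := H l; rewrite !ffunE => /perm_inj.
Qed.

Lemma pop_surj f : equivariant f -> exists x, pop x = f.
Proof.
move=> fS.
pose G (g : vert r -> 'I_n) := f (tbasis [ffun l => g (inr l)]) [ffun l => g (inl l)].
(* Equivariance makes the matrix entry [G g] depend only on the level sets of [g]. *)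
have G_ker g h : ker_diag g = ker_diag h -> G g = G h.
  move=> /eq_ker_perm[s sE].
  rewrite /G -(tpow_perm_tbasis s) fS tpow_permE; congr (f (tbasis _) _);
    by apply/ffunP => l; rewrite !ffunE sE.
have [lam lamE] : exists lam : diag r -> vert r -> 'I_n, forall q, ker_diag (lam q) = q.
  by have [lam H] := choice exists_labelling; exists lam.
(* Inverting the zeta transform gives coefficients whose operator has the prescribed entry at one
   labelling of each kind. *)
have [x xE] := zeta_surj [ffun q => G (lam q)].
exists x; apply/lfunP => t; rewrite (tpow_sumE t) !linear_sum; apply: eq_bigr => j _.
rewrite !linearZ; congr (_ *: _); apply/ffunP => i.
have := zeta_ker x (lab i j); rewrite xE ffunE (G_ker _ (lab i j)) ?lamE // /G.
have -> : [ffun l => lab i j (inr l)] = j by apply/ffunP => l; rewrite ffunE.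
by have -> : [ffun l => lab i j (inl l)] = i by apply/ffunP => l; rewrite ffunE.
Qed.

End PartitionAlgebraAction.

(** * Painted diagrams *)
Section Kappa.
Variables (r k : nat).
Implicit Types (a b : W r k) (p q : diag r) (s t : 'S_r).

Lemma youngP a s : reflect (forall l, interval a (s l) = interval a l) (s \in young a).
Proof. by rewrite inE; apply: (iffP 'forall_eqP). Qed.

Lemma young1 a : 1%g \in young a.
Proof. by apply/youngP => l; rewrite perm1. Qed.

Lemma youngM a s t : s \in young a -> ((t * s)%g \in young a) = (t \in young a).
Proof.
by move=> /youngP sY; apply/youngP/youngP => H l; have := H l; rewrite permM sY.
Qed.

Lemma youngV a s : (s^-1%g \in young a) = (s \in young a).
Proof.
by apply/youngP/youngP => H l; [rewrite -(H (s l)) permK|rewrite -(H (s^-1%g l)) permKV].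
Qed.

Lemma card_paint_inl a b j : #|[set x | paint a b x == inl j]| = part a j.
Proof.
rewrite -card_interval -(card_imset _ (@inl_inj 'I_r 'I_r)).
apply: eq_card => x; rewrite !inE; apply/eqP/imsetP => [|[l /[!inE] /eqP <- -> //]].
by case: x => // l [<-]; exists l; rewrite ?inE.
Qed.

Lemma card_paint_inr a b j : #|[set x | paint a b x == inr j]| = part b j.
Proof.
rewrite -card_interval -(card_imset _ (@inr_inj 'I_r 'I_r)).
apply: eq_card => x; rewrite !inE; apply/eqP/imsetP => [|[l /[!inE] /eqP <- -> //]].
by case: x => // l [<-]; exists l; rewrite ?inE.
Qed.

Section FiberMultiset.
Variables (a b : W r k) (m : nat) (g : vert r -> 'I_m).

Definition fiber_mset (c : 'I_m) : ({mset colour k})%mset :=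
  seq_mset [seq paint a b x | x <- enum [set x | g x == c]].

Lemma fiber_msetE c y :
  fiber_mset c y = #|[set x | (paint a b x == y) && (g x == c)]|.
Proof.
rewrite mset_seqE count_map -size_filter cardE; congr size.
by rewrite /enum_mem -filter_predI; apply: eq_filter => x; rewrite /= !inE.
Qed.

Lemma sum_fiber_mset y : (\sum_c fiber_mset c y = #|[set x | paint a b x == y]|)%N.
Proof.
rewrite -sum1_card (partition_big g predT) //=; apply: eq_bigr => c _.
by rewrite fiber_msetE -sum1_card; apply: eq_bigl => x; rewrite !inE.
Qed.

Hypothesis g_surj : forall c, exists x, g x = c.

(** As [g] is onto, its fibres are pairwise distinct and are exactly the blocks of [ker_diag g], so
    indexing by values lists each block once. *)
Lemma kappa_fibers : kappa a b (ker_diag g) = seq_mset [seq fiber_mset c | c <- enum 'I_m].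
Proof.
rewrite /kappa; apply/eq_seq_msetP.
pose F c := [set x | g x == c].
have -> : [seq fiber_mset c | c <- enum 'I_m] = [seq seq_mset [seq paint a b x
   | x <- enum (B : {set vert r})] | B <- [seq F c | c <- enum 'I_m]].
  by rewrite -map_comp; apply: eq_map.
apply: perm_map; apply: uniq_perm; rewrite ?enum_uniq //.
  rewrite map_inj_uniq ?enum_uniq // => c d /setP cd.
  by have [x xc] := g_surj c; have := cd x; rewrite !inE xc eqxx => /esym/eqP.
move=> B; rewrite mem_enum; apply/imsetP/mapP => [[x _ ->]|[c _ ->]].
  by exists (g x); rewrite ?mem_enum //; apply/setP => y; rewrite !inE eq_sym.
have [x xc] := g_surj c; exists x => //; apply/setP => y; rewrite !inE xc eq_sym //.
Qed.

End FiberMultiset.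

(** Numbering the blocks puts any diagram in the form to which [kappa_fibers] applies. *)
Lemma exists_block_index p : exists m, exists2 g : vert r -> 'I_m,
  (forall c, exists x, g x = c) & ker_diag g = p.
Proof.
have pP x : finset.pblock (val p) x \in val p by apply: pblock_mem; exact: diag_cover.
pose C : finType := {B : {set vert r} | B \in val p}.
pose g x : 'I_#|C| := enum_rank (Sub (finset.pblock (val p) x) (pP x) : C).
exists #|C|, g => [c|].
  have := valP (enum_val c); set B := val (enum_val c) => Bp.
  have /and3P[_ tI B0] := valP p.
  have /set0Pn[x xB] : B != finset.set0 by apply: contraNneq B0 => <-.
  exists x; apply: enum_val_inj; apply: val_inj; rewrite enum_rankK /=.
  exact: def_pblock.
apply: diag_rel_inj => x y; rewrite ker_diagE diag_relE (inj_eq enum_rank_inj).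
by rewrite -val_eqE.
Qed.

Definition vert_map s t (x : vert r) : vert r :=
  match x with inl l => inl (s l) | inr l => inr (t l) end.

Lemma vert_mapK s t : cancel (vert_map s t) (vert_map s^-1 t^-1).
Proof. by case=> l /=; rewrite permK. Qed.

Lemma vert_mapKV s t : cancel (vert_map s^-1 t^-1) (vert_map s t).
Proof. by case=> l /=; rewrite permKV. Qed.

(* the diagram of L_{s^-1} L_p L_t *)
Definition diag_act s t p := ker_diag (finset.pblock (val p) \o vert_map s t).

Lemma diag_actE s t p x y : diag_rel (diag_act s t p) x y = diag_rel p (vert_map s t x) (vert_map s t y).
Proof. by rewrite ker_diagE diag_relE. Qed.

Lemma paint_vert_map a b s t x : s \in young a -> t \in young b ->
  paint a b (vert_map s t x) = paint a b x.
Proof. by move=> /youngP sa /youngP tb; case: x => l /=; rewrite ?sa ?tb. Qed.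

(** The vertex permutation preserves colours and carries each block onto the block with the same
    number. *)
Lemma kappa_diag_act a b s t p : s \in young a -> t \in young b ->
  kappa a b (diag_act s t p) = kappa a b p.
Proof.
move=> sa tb; have [m [g gs <-]] := exists_block_index p.
have -> : diag_act s t (ker_diag g) = ker_diag (g \o vert_map s t).
  by apply: diag_rel_inj => x y; rewrite diag_actE !ker_diagE.
rewrite !kappa_fibers // => [|c]; last first.
  by have [x <-] := gs c; exists (vert_map s^-1 t^-1 x); rewrite /= vert_mapKV.
congr seq_mset; apply: eq_map => c; apply/msetP => y; rewrite !fiber_msetE.
rewrite -(card_imset _ (can_inj (vert_mapK s t))); apply: eq_card => x; rewrite !inE.
apply/imsetP/andP => [[z /[!inE] /andP[]]|[px gx]].
  by rewrite -(paint_vert_map _ sa tb) => ? ? ->.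
by exists (vert_map s^-1 t^-1 x); rewrite ?vert_mapKV // inE /= -(paint_vert_map _ sa tb) vert_mapKV px.
Qed.

(* Equality of the painted diagrams matches the blocks of p with those of q; a
   vertex permutation preserving (colour, matched block) splits into s and t. *)
Lemma kappa_eq_diag_act a b p q : kappa a b p = kappa a b q ->
  exists s t, [/\ s \in young a, t \in young b & p = diag_act s t q].
Proof.
have [m [g gs <-]] := exists_block_index p.
have [m' [h hs <-]] := exists_block_index q.
rewrite !kappa_fibers // => /eq_seq_msetP E.
have mm : m = m' by have := perm_size E; rewrite size_map size_enum_ord size_map size_enum_ord.
subst m'.
have [be beE] : exists be : 'S_m, forall c, fiber_mset a b g c = fiber_mset a b h (be c).
  by apply: perm_of_eq_fibers => y; rewrite !card_fiber_map; move/seq.permP: E => ->.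
have [s sE] : exists s : {perm vert r}, forall x,
    (paint a b x, be (g x)) = (paint a b (s x), h (s x)).
  apply: (@perm_of_eq_fibers _ _ (fun x => (paint a b x, be (g x)))
            (fun x => (paint a b x, h x))) => -[y c].
  have := congr1 (fun M : ({mset colour k})%mset => M y) (beE (be^-1%g c)).
  rewrite permKV !fiber_msetE => E1.
  transitivity #|[set x | (paint a b x == y) && (h x == c)]|.
    rewrite -E1; apply: eq_card => x; rewrite !inE -pair_eqE /=; congr (_ && _).
    by rewrite -[RHS](inj_eq (@perm_inj _ be)) permKV.
  by apply: eq_card => x; rewrite !inE.
have sp x : paint a b (s x) = paint a b x by have [] := sE x.
have sh x : h (s x) = be (g x) by have [] := sE x.
(* The fallback value [l] is never taken: [s] preserves colours, hence the two rows. *)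
pose u1 l := if s (inl l) is inl l' then l' else l.
pose u2 l := if s (inr l) is inr l' then l' else l.
have u1E l : s (inl l) = inl (u1 l) by have := sp (inl l); rewrite /u1; case: (s (inl l)).
have u2E l : s (inr l) = inr (u2 l) by have := sp (inr l); rewrite /u2; case: (s (inr l)).
have u1I : injective u1.
  by move=> x y xy; have := u1E x; rewrite xy -u1E => /perm_inj[].
have u2I : injective u2.
  by move=> x y xy; have := u2E x; rewrite xy -u2E => /perm_inj[].
have sv x : vert_map (perm u1I) (perm u2I) x = s x.
  by case: x => l /=; rewrite permE ?u1E ?u2E.
exists (perm u1I), (perm u2I); split.
- by apply/youngP => l; have := sp (inl l); rewrite u1E permE => e; apply: (@inl_inj 'I_k 'I_k).
- by apply/youngP => l; have := sp (inr l); rewrite u2E permE => e; apply: (@inr_inj 'I_k 'I_k).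
apply: diag_rel_inj => x y; rewrite diag_actE !ker_diagE !sv !sh.
by rewrite (inj_eq perm_inj).
Qed.

Lemma kappa_unbarred a b p j : unbarred (kappa a b p) j = part a j.
Proof.
have [m [g gs <-]] := exists_block_index p.
rewrite kappa_fibers // /unbarred (perm_big _ (perm_eq_seq_mset _)) big_map.
by rewrite big_enum /= sum_fiber_mset card_paint_inl.
Qed.

Lemma kappa_barred a b p j : barred (kappa a b p) j = part b j.
Proof.
have [m [g gs <-]] := exists_block_index p.
rewrite kappa_fibers // /barred (perm_big _ (perm_eq_seq_mset _)) big_map.
by rewrite big_enum /= sum_fiber_mset card_paint_inr.
Qed.

Lemma has_mult_kappa a b p : has_mult (kappa a b p) a b.
Proof. by split=> j; rewrite ?kappa_unbarred ?kappa_barred. Qed.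

Lemma has_mult_inj pt a b c d : has_mult pt a b -> has_mult pt c d -> a = c /\ b = d.
Proof.
by move=> [ua bb] [uc bd]; split; apply: W_ext => j; rewrite -?ua -?bb.
Qed.

Lemma sum_part a : (\sum_j part a j = r)%N.
Proof. by rewrite -[RHS](eqP (valP a)) sumnE big_map big_tuple. Qed.

Lemma kappa_msPi a b p : @msPi r k (kappa a b p).
Proof.
split; last 2 first.
- by under eq_bigr do rewrite kappa_unbarred; exact: sum_part.
- by under eq_bigr do rewrite kappa_barred; exact: sum_part.
have [m [g gs <-]] := exists_block_index p.
rewrite kappa_fibers // (perm_mem (perm_eq_seq_mset _)); apply/mapP => -[c _ /esym c0].
have [x xc] := gs c; have := fiber_msetE a b g c (paint a b x).
rewrite c0 mset0E => /esym/eqP; rewrite cards_eq0 => /eqP/setP/(_ x).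
by rewrite !inE xc !eqxx.
Qed.

(** Each member of [pt] prescribes how many vertices of each colour go to its block, and
    [exists_fiber_split] supplies such a distribution. Members being nonempty, every block is
    inhabited. *)
Lemma kappa_surj (pt : mspartition k) : @msPi r k pt ->
  exists a b p, kappa a b p = pt.
Proof.
case=> pt0 /W_exists[a aE] /W_exists[b bE].
pose m := size (enum_mset pt); pose B (c : 'I_m) := nth mset0 (enum_mset pt) c.
have sumB y : (\sum_c B c y = \sum_(M <- enum_mset pt) (M : ({mset colour k})%mset) y)%N.
  by rewrite (big_nth mset0) big_mkord.
have [y|g gE] := @exists_fiber_split (vert r) ('I_k + 'I_k)%type 'I_m (paint a b) (fun y c => B c y).
  rewrite sumB; case: y => j; first by rewrite card_paint_inl aE.
  by rewrite card_paint_inr bE.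
have fE c : fiber_mset a b g c = B c by apply/msetP => y; rewrite fiber_msetE; exact: gE.
have gs c : exists x, g x = c.
  have /eqP Bc : B c != mset0 by apply: contraNneq pt0 => <-; exact: mem_nth.
  apply: contrapT => /forallNP gN; apply: Bc; apply/msetP => y; rewrite -fE mset0E.
  rewrite fiber_msetE; apply/eqP; rewrite cards_eq0; apply/eqP/setP => x; rewrite !inE.
  by apply/negP => /andP[_ /eqP/gN].
exists a, b, (ker_diag g); rewrite kappa_fibers //.
have -> : [seq fiber_mset a b g c | c <- enum 'I_m] = enum_mset pt.
  rewrite (eq_map fE); apply: (@eq_from_nth _ mset0).
    by rewrite size_map size_enum_ord.
  move=> i; rewrite size_map size_enum_ord => im.
  by rewrite (nth_map (Ordinal im)) ?size_enum_ord // /B nth_enum_ord.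
exact: seq_mset_id.
Qed.

End Kappa.

(** * The corners of the partition algebra *)
Section WordAction.
Variables r n k : nat.
Notation word := {ffun 'I_r -> 'I_n}.
Implicit Types (i j : word) (s t : 'S_r).

Definition word_act i s : word := [ffun l => i (s l)].

Lemma word_actM i s t : word_act (word_act i s) t = word_act i (t * s)%g.
Proof. by apply/ffunP => l; rewrite !ffunE permM. Qed.

Lemma word_actK s : cancel (word_act^~ s) (word_act^~ s^-1%g).
Proof. by move=> i; apply/ffunP => l; rewrite !ffunE permKV. Qed.

Lemma word_actKV s : cancel (word_act^~ s^-1%g) (word_act^~ s).
Proof. by move=> i; apply/ffunP => l; rewrite !ffunE permK. Qed.

Lemma compatible_perm_diag s i j : compatible (perm_diag s) i j = (j == word_act i s).
Proof.
have rel l : diag_rel (perm_diag s) (inl (s l)) (inr l).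
  apply/diag_relP; exists [set inl (s l); inr l]; first by apply/imsetP; exists l.
  by rewrite !inE !eqxx.
apply/compatibleP/eqP => [H|-> x y].
  by apply/ffunP => l; rewrite ffunE -[LHS](H _ _ (rel l)).
case/diag_relP => _ /imsetP[l _ ->]; rewrite !inE => -[].
by do 2![case/orP => /eqP->]; rewrite /= ?ffunE.
Qed.

Lemma compatible_diag_act s t p i j :
  compatible (diag_act s t p) i (word_act j t) = compatible p (word_act i s^-1%g) j.
Proof.
have labE x : lab i (word_act j t) x = lab (word_act i s^-1%g) j (vert_map s t x).
  by case: x => l /=; rewrite ffunE ?permK.
apply/compatibleP/compatibleP => H x y.
  rewrite -{1}(vert_mapKV s t x) -{1}(vert_mapKV s t y) -diag_actE => /H.
  by rewrite !labE !vert_mapKV.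
by rewrite diag_actE => /H; rewrite !labE.
Qed.

End WordAction.

(** * Spans and free families *)

Section LinearSpan.
Variables (K : fieldType) (V : vectType K).

Lemma lspan_vspace (S : set V) (U : {vspace V}) (x : V) :
  (forall y : V, S y -> y \in U) -> lspan S x -> x \in U.
Proof. by move=> SU [s sS]; apply/subvP/span_subvP => y /sS/SU. Qed.

Lemma lspan_sum (S : set V) (I : finType) (c : I -> K) (v : I -> V) :
  (forall i, S (v i)) -> lspan S (\sum_i c i *: v i).
Proof.
move=> Sv; exists [seq v i | i <- enum I] => [_ /mapP[i _ ->]//|].
by apply: memv_suml => i _; apply: memvZ; apply: memv_span; apply: map_f; rewrite mem_enum.
Qed.

(** Applying the functional attached to one index to a vanishing combination leaves that coefficient
    times a nonzero scalar. *)
Lemma free_functionals (I : eqType) (s : seq I) (v : I -> V) :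
  uniq s ->
  (forall i, i \in s -> exists phi : {scalar V},
     forall j, j \in s -> (phi (v j) == 0) = (i != j)) ->
  free (map v s).
Proof.
move=> us phiP; rewrite -[map v s]/(tval (in_tuple (map v s))); apply/freeP => c c0 i.
have nthE (j : 'I_(size (map v s))) :
    exists2 u, u \in s & (in_tuple (map v s))`_j = v u /\ forall i0, nth i0 s j = u.
  have jm : (j < size s)%N by rewrite -(size_map v).
  have [i0 _] : exists i0 : I, true by case: (s) (nat_of_ord j) jm => // i0; exists i0.
  exists (nth i0 s j); first exact: mem_nth.
  by split=> [|i1]; [rewrite (nth_map i0)|exact: set_nth_default].
have [u us' [uE nu]] := nthE i; have [phi phiE] := phiP u us'.
have := congr1 phi c0; rewrite linear_sum linear0 (bigD1 i) //= big1 => [|j ji].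
  by rewrite addr0 linearZ uE => /eqP; rewrite /= mulf_eq0 phiE // eqxx orbF => /eqP.
have [w ws [wE nw]] := nthE j.
rewrite linearZ wE /=; apply/eqP; rewrite mulf_eq0 phiE //.
have lt (l : 'I_(size (map v s))) : (l < size s)%N by rewrite -(size_map v).
by rewrite -{1}(nu u) -(nw u) nth_uniq // [X in ~~ X]eq_sym ji orbT.
Qed.

End LinearSpan.

(** * Corner projections and the painted diagram basis *)

Section Corner.
Variables (K : numFieldType) (r n k : nat).
Implicit Types (a b : W r k) (p q : diag r) (x y : palg K r).
Notation word := {ffun 'I_r -> 'I_n}.
Notation tp := (tpow K r n).
Notation pop := (@palg_op K r n).

Lemma pop_perm_diag s t i : pop (L K (perm_diag s)) t i = t (word_act i s).
Proof.
by rewrite popL; under eq_bigl do rewrite compatible_perm_diag; rewrite big_pred1_eq.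
Qed.

Lemma card_young_neq0 a : #|young a|%:R != 0 :> K.
Proof. by rewrite pnatr_eq0 -lt0n; apply/card_gt0P; exists 1%g; exact: young1. Qed.

Lemma pop_symE a t i :
  pop (sym K a) t i = #|young a|%:R^-1 * \sum_(s in young a) t (word_act i s).
Proof.
rewrite linearZ scale_lfunE ffun_scaleE linear_sum sum_lfunE sum_ffunE.
by congr (_ * _); apply: eq_bigr => s _; rewrite pop_perm_diag.
Qed.

Lemma pop_sym_invariant a t i s : s \in young a ->
  pop (sym K a) t (word_act i s) = pop (sym K a) t i.
Proof.
move=> sY; rewrite !pop_symE; congr (_ * _).
rewrite (reindex_inj (mulIg s^-1)%g) /=.
apply: eq_big => [u|u _]; first by rewrite youngM ?youngV.
by rewrite word_actM -mulgA mulVg mulg1.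
Qed.

Lemma pop_sym_id a (t : tp) : (forall i s, s \in young a -> t (word_act i s) = t i) ->
  pop (sym K a) t = t.
Proof.
move=> tY; apply/ffunP => i; rewrite pop_symE.
under eq_bigr => s sY do rewrite tY //.
by rewrite sumr_const -[t i *+ _]mulr_natl mulKf // card_young_neq0.
Qed.

Lemma pop_sym_sym a t : pop (sym K a) (pop (sym K a) t) = pop (sym K a) t.
Proof. by apply: pop_sym_id => i s; exact: pop_sym_invariant. Qed.

Hypothesis n_gt0 : (0 < n)%N.

Definition corner_proj a b x : palg K r := pmul n (pmul n (sym K a) x) (sym K b).

Lemma pop_corner_proj a b x t :
  pop (corner_proj a b x) t = pop (sym K a) (pop x (pop (sym K b) t)).
Proof. by rewrite /corner_proj !pop_mul // !comp_lfunE. Qed.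

Hypothesis n_ge2r : (2 * r <= n)%N.
Let inj := @pop_inj K r n n_ge2r.

Lemma corner_proj_linear a b : linear (corner_proj a b).
Proof.
move=> c x y; apply: inj; apply/lfunP => t; rewrite linearP add_lfunE scale_lfunE.
by rewrite !pop_corner_proj linearP add_lfunE scale_lfunE linearP.
Qed.
HB.instance Definition _ a b :=
  GRing.isLinear.Build K (palg K r) (palg K r) _ (corner_proj a b) (corner_proj_linear a b).

Lemma corner_proj_idem a b x : corner_proj a b (corner_proj a b x) = corner_proj a b x.
Proof. by apply: inj; apply/lfunP => t; rewrite !pop_corner_proj !pop_sym_sym. Qed.

Lemma cornerP a b x : corner n a b x <-> corner_proj a b x = x.
Proof. by split=> [[y _ <-]|<-]; [exact: corner_proj_idem|exists x]. Qed.

Lemma corner_popP a b x :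
  corner n a b x <-> (forall t, pop (sym K a) (pop x (pop (sym K b) t)) = pop x t).
Proof.
rewrite cornerP; split=> [xE t|H]; first by rewrite -pop_corner_proj xE.
by apply: inj; apply/lfunP => t; rewrite pop_corner_proj.
Qed.

(** Both Young averages act by permuting tensor places, so the product is the average of [L] over
    the orbit of [p] under the two Young subgroups. *)
Lemma corner_projL a b p : corner_proj a b (L K p) = (#|young a|%:R^-1 * #|young b|%:R^-1) *:
  \sum_(s in young a) \sum_(t in young b) L K (diag_act s t p).
Proof.
apply: inj; apply/lfunP => v; apply/ffunP => i.
rewrite pop_corner_proj pop_symE [in RHS]linearZ scale_lfunE [RHS]ffun_scaleE -mulrA.
congr (_ * _).
(* Inverting [s] matches the twist of the top word by [s^-1] in [compatible_diag_act]. *)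
rewrite linear_sum sum_lfunE sum_ffunE mulr_sumr (reindex_inj invg_inj) /=.
apply: eq_big => [s|s _]; first exact: youngV.
rewrite linear_sum sum_lfunE sum_ffunE popL.
under eq_bigr do rewrite pop_symE.
rewrite -mulr_sumr exchange_big; congr (_ * _); apply: eq_bigr => t _ /=.
rewrite [RHS]popL [RHS](reindex (fun j => word_act j t)) /=; last first.
  by exists (fun j => word_act j t^-1%g) => j _; rewrite ?word_actK ?word_actKV.
by apply: eq_bigl => j; rewrite compatible_diag_act.
Qed.

(** Up to a nonzero factor the coefficient is a cardinality, so in characteristic zero it vanishes
    exactly when [q] lies outside the orbit of [p]. *)
Lemma corner_projL_coef a b p q : corner_proj a b (L K p) q =
  (#|young a|%:R^-1 * #|young b|%:R^-1) *
  #|[set st : 'S_r * 'S_r | [&& st.1 \in young a, st.2 \in young b & q == diag_act st.1 st.2 p]]|%:R.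
Proof.
rewrite corner_projL ffun_scaleE; congr (_ * _).
rewrite pair_big sum_ffunE -sum1_card natr_sum big_mkcond [RHS]big_mkcond /=.
apply: eq_bigr => st _; rewrite ffunE [in RHS]inE.
by case: (st.1 \in _); case: (st.2 \in _) => //=; case: (q == _).
Qed.

Lemma corner_projL_diag_act a b s t p : s \in young a -> t \in young b ->
  corner_proj a b (L K (diag_act s t p)) = corner_proj a b (L K p).
Proof.
move=> sa tb; rewrite [LHS]corner_projL [RHS]corner_projL.
apply: (congr1 (fun x => _ *: x)).
rewrite [RHS](reindex_inj (mulIg s)) /=.
apply: eq_big => [u|u _]; first by rewrite youngM.
rewrite [RHS](reindex_inj (mulIg t)) /=.
apply: eq_big => [v|v _]; first by rewrite youngM.
congr L; apply: diag_rel_inj => x y; rewrite !diag_actE.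
by congr (diag_rel p _ _); [case: x|case: y] => l /=; rewrite permM.
Qed.

(** Multiplicities determine the weights, so only the summand at [(a, b)] survives. The picked
    representative may differ from [p], but lies in its orbit, on which the corner projection is
    constant. *)
Lemma D_kappa a b p : D K r n (kappa a b p) = painted_inj a b (corner_proj a b (L K p)).
Proof.
rewrite /D (bigD1 a) //= [X in _ + X]big1 ?addr0 => [|c ca].
  rewrite (bigD1 b) //= [X in _ + X]big1 ?addr0 => [|c cb].
    case: pickP => [q /eqP/kappa_eq_diag_act[s [t [sa tb ->]]]|/(_ p)]; last by rewrite eqxx.
    exact: congr1 (corner_projL_diag_act p sa tb).
  case: pickP => // q /eqP E; have := has_mult_kappa a c q; rewrite E.
  by move=> /has_mult_inj/(_ (has_mult_kappa a b p))[_ cE]; rewrite cE eqxx in cb.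
apply: big1 => d _; case: pickP => // q /eqP E; have := has_mult_kappa c d q; rewrite E.
by move=> /has_mult_inj/(_ (has_mult_kappa a b p))[cE]; rewrite cE eqxx in ca.
Qed.

Lemma painted_inj_linear a b : linear (@painted_inj K r k a b).
Proof.
move=> c x y; apply/ffunP => u; rewrite !ffunE.
by case: eqP => // _; rewrite scaler0 addr0.
Qed.
HB.instance Definition _ a b := GRing.isLinear.Build K (palg K r)
  (painted_space K r k) _ (painted_inj a b) (painted_inj_linear a b).

Lemma corner_projE a b x : corner_proj a b x = \sum_p x p *: corner_proj a b (L K p).
Proof.
rewrite {1}(palg_sumE x) linear_sum; apply: eq_bigr => p _; exact: linearZ.
Qed.

Lemma corner_lspan a :
  [set painted_inj a a x | x in corner (K := K) n a a]%classic =
  lspan [set D K r n pt | pt in [set pt | @msPi r k pt /\ has_mult pt a a]]%classic.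
Proof.
apply/seteqP; split=> [_ [x /cornerP xE <-]|z].
  rewrite -xE corner_projE linear_sum.
  under eq_bigr do rewrite linearZ /= -D_kappa.
  apply: lspan_sum => p; exists (kappa a a p) => //.
  by split; [exact: kappa_msPi|exact: has_mult_kappa].
(* The span lies in the image of this linear map, whose values come from the corner. *)
pose F := linfun (painted_inj a a \o corner_proj a a).
move=> /(@lspan_vspace _ _ _ (limg F)) zF.
have /memv_imgP[x _ ->] : z \in limg F.
  apply: zF => _ [pt [/kappa_surj[b [c [p <-]]] m] <-].
  have [-> ->] := has_mult_inj (has_mult_kappa b c p) m.
  by rewrite D_kappa -[painted_inj _ _ _](lfunE (painted_inj a a \o corner_proj a a)) memv_img ?memvf.
by rewrite lfunE /=; exists (corner_proj a a x) => //; apply/cornerP; exact: corner_proj_idem.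
Qed.

Lemma painted_sumE (x : painted_space K r k) :
  x = \sum_u painted_inj u.1 u.2 (x u).
Proof.
apply/ffunP => u; rewrite sum_ffunE (bigD1 u) //= big1 ?addr0 => [|v /negbTE vu].
  by rewrite ffunE -surjective_pairing eqxx.
by rewrite ffunE -surjective_pairing eq_sym vu.
Qed.

(** Entrywise projection onto the corners; its image is a subspace containing every [D], which
    bounds their span. *)
Definition painted_proj (x : painted_space K r k) : painted_space K r k :=
  [ffun u => corner_proj u.1 u.2 (x u)].

Lemma painted_proj_linear : linear painted_proj.
Proof. by move=> c x y; apply/ffunP => u; rewrite !ffunE linearP. Qed.
HB.instance Definition _ := GRing.isLinear.Build K (painted_space K r k)
  (painted_space K r k) _ painted_proj painted_proj_linear.

Lemma painted_lspan : lspan [set D K r n pt | pt in @msPi r k]%classic = painted (k := k) n.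
Proof.
apply/seteqP; split=> [z|z zP].
  move=> /(@lspan_vspace _ _ _ (limg (linfun painted_proj))) zF.
  have /memv_imgP[x _ ->] : z \in limg (linfun painted_proj).
    apply: zF => _ [_ /kappa_surj[b [c [p <-]]] <-].
    rewrite D_kappa; apply/memv_imgP; exists (painted_inj b c (L K p)); rewrite ?memvf //.
    rewrite lfunE /=; apply/ffunP => -[u v]; rewrite !ffunE; case: eqP => [[-> ->]//|_].
    by rewrite linear0.
  by move=> a b; rewrite lfunE /= ffunE; apply/cornerP; exact: corner_proj_idem.
have -> : z = \sum_(up : (W r k * W r k) * diag r)
    z up.1 up.2 *: D K r n (kappa up.1.1 up.1.2 up.2).
  rewrite {1}(painted_sumE z) -(pair_bigA _ (fun u p => z u p *: D K r n (kappa u.1 u.2 p))) /=.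
  apply: eq_bigr => -[a b] _; have /cornerP {1}<- := zP a b.
  by rewrite corner_projE linear_sum; apply: eq_bigr => p _; rewrite linearZ /= D_kappa.
by apply: lspan_sum => -[[a b] p]; exists (kappa a b p) => //; exact: kappa_msPi.
Qed.

Definition painted_coef (u : W r k * W r k) p (x : painted_space K r k) : K := x u p.
Lemma painted_coef_scalar u p : scalar (painted_coef u p).
Proof. by move=> c x y; rewrite /painted_coef !ffunE. Qed.
HB.instance Definition _ u p := GRing.isLinear.Build K (painted_space K r k)
  K *%R (painted_coef u p) (painted_coef_scalar u p).

(** For each painted diagram, the coordinate at one representative [p] separates it from the others:
    it is nonzero only on diagrams whose representatives share the orbit of [p]. *)
Lemma D_lfree : lfree (@msPi r k) (fun pt : mspartition k => D K r n pt).
Proof.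
move=> s us sP; apply: free_functionals => // _ /sP/kappa_surj[a [b [p <-]]].
exists (painted_coef (a, b) p) => _ /sP/kappa_surj[a' [b' [p' <-]]].
rewrite /= /painted_coef D_kappa ffunE; case: ((a, b) =P (a', b')) => [[-> ->]|ab]; last first.
  rewrite ffunE eqxx; apply/esym/eqP => E; apply: ab; have := has_mult_kappa a b p.
  by rewrite E => /has_mult_inj/(_ (has_mult_kappa a' b' p'))[-> ->].
rewrite corner_projL_coef !mulf_eq0 !invr_eq0 !(negbTE (card_young_neq0 _)) /=.
rewrite pnatr_eq0 cards_eq0.
apply/idP/idP => [/eqP/setP H|/eqP ne].
  apply/eqP => E; have [t [u [ta ub pE]]] := kappa_eq_diag_act E.
  by have := H (t, u); rewrite [LHS]inE [RHS]inE /= ta ub pE eqxx.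
apply/eqP/setP => -[t u]; rewrite [LHS]inE [RHS]inE /=; apply/negP => /and3P[ta ub /eqP pE].
by apply: ne; rewrite pE kappa_diag_act.
Qed.

End Corner.

(** * Endomorphism algebras as corners *)
Lemma alg_iso_can (K : fieldType) (A B : subAlgebra K)
    (f : {linear ambient A -> ambient B}) (g : ambient B -> ambient A) :
  (forall x, carrier A x -> carrier B (f x)) ->
  (forall y, carrier B y -> carrier A (g y)) ->
  (forall x, carrier A x -> g (f x) = x) ->
  (forall y, carrier B y -> f (g y) = y) ->
  (forall x y, carrier A x -> carrier A y -> f (amul x y) = amul (f x) (f y)) ->
  f (aone A) = aone B ->
  alg_iso A B.
Proof.
move=> fAB gBA fK gK fM f1; exists f; split=> //; split=> //.
- by move=> x y /set_mem Ax /set_mem Ay xy; rewrite -(fK x) // -(fK y) // xy.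
- by move=> y By; exists (g y); [exact: gBA|exact: gK].
Qed.

Section Conjugation.
Variables (K : fieldType) (S T U V : vectType K) (p : 'Hom(T, U)) (q : 'Hom(V, S)).

Definition lconj (f : 'Hom(S, T)) : 'Hom(V, U) := (p \o f \o q)%VF.

Lemma lconjE f x : lconj f x = p (f (q x)).
Proof. by rewrite !comp_lfunE. Qed.

Lemma lconj_linear : linear lconj.
Proof.
move=> c f g; apply/lfunP => x; rewrite add_lfunE scale_lfunE !lconjE.
by rewrite add_lfunE scale_lfunE linearP.
Qed.
HB.instance Definition _ :=
  GRing.isLinear.Build K 'Hom(S, T) 'Hom(V, U) _ lconj lconj_linear.

End Conjugation.

(** Conjugation by an equivariant linear isomorphism. *)
Lemma EndS_alg_iso (K : fieldType) (n : nat) (T1 T2 : vectType K)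
    (rho1 : 'S_n -> T1 -> T1) (rho2 : 'S_n -> T2 -> T2)
    (p : 'Hom(T1, T2)) (q : 'Hom(T2, T1)) :
  cancel p q -> cancel q p -> (forall s x, p (rho1 s x) = rho2 s (p x)) ->
  alg_iso (EndS rho1) (EndS rho2).
Proof.
move=> pK qK pS.
have qS s x : q (rho2 s x) = rho1 s (q x) by rewrite -{1}(qK x) -pS pK.
apply: (@alg_iso_can _ (EndS rho1) (EndS rho2) (lconj p q) (lconj q p)) => /=.
- by move=> f fS s x; rewrite !lconjE qS fS pS.
- by move=> f fS s x; rewrite !lconjE pS fS qS.
- by move=> f _; apply/lfunP => x; rewrite !lconjE !pK.
- by move=> f _; apply/lfunP => x; rewrite !lconjE !qK.
- by move=> f g _ _; apply/lfunP => x; rewrite !(lconjE, comp_lfunE) pK.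
- by apply/lfunP => x; rewrite lconjE !id_lfunE qK.
Qed.

(** Each [th] embeds its space equivariantly onto the image of [s_a], with retraction [xi]; passing
    through this common image gives the isomorphism [xi2 \o th1]. *)
Lemma EndS_sym_iso (K : numFieldType) (r n k : nat) (a : W r k) (T1 T2 : vectType K)
    (rho1 : 'S_n -> T1 -> T1) (rho2 : 'S_n -> T2 -> T2)
    (th1 : 'Hom(T1, tpow K r n)) (xi1 : 'Hom(tpow K r n, T1))
    (th2 : 'Hom(T2, tpow K r n)) (xi2 : 'Hom(tpow K r n, T2)) :
  cancel th1 xi1 -> (forall t, th1 (xi1 t) = palg_op n (sym K a) t) ->
  (forall s x, th1 (rho1 s x) = tpow_mx (perm_mx s) (th1 x)) ->
  cancel th2 xi2 -> (forall t, th2 (xi2 t) = palg_op n (sym K a) t) ->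
  (forall s x, th2 (rho2 s x) = tpow_mx (perm_mx s) (th2 x)) ->
  alg_iso (EndS rho1) (EndS rho2).
Proof.
move=> K1 E1 S1 K2 E2 S2.
apply: (@EndS_alg_iso _ _ _ _ _ _ (xi2 \o th1)%VF (xi1 \o th2)%VF).
- by move=> x; rewrite !comp_lfunE E2 -E1 !K1.
- by move=> x; rewrite !comp_lfunE E1 -E2 !K2.
- by move=> s x; rewrite !comp_lfunE S1; apply: (can_inj K2); rewrite E2 S2 E2 pop_equivariant.
Qed.

Section CornerIso.
Variables (K : numFieldType) (r n k : nat).
Notation tp := (tpow K r n).
Notation pop := (@palg_op K r n).
Hypotheses (n_gt0 : (0 < n)%N) (n_ge2r : (2 * r <= n)%N).
Variables (T : vectType K) (rho : 'S_n -> T -> T).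

(** A left inverse of [pop] everywhere, and a right inverse on equivariant operators by
    [pop_invK]. *)
Definition pop_inv : 'End(tp) -> palg K r := (linfun pop)^-1%VF.

Lemma popK : cancel pop pop_inv.
Proof.
have ker0 : lker (linfun pop) == 0%VS.
  by apply/lker0P => x y; rewrite !lfunE; exact: pop_inj.
by move=> x; rewrite /pop_inv -[pop x](lfunE pop) lker0_lfunK.
Qed.

Lemma pop_invK f : equivariant f -> pop (pop_inv f) = f.
Proof. by move=> /(pop_surj n_ge2r)[x <-]; rewrite popK. Qed.

HB.instance Definition _ := GRing.Linear.copy pop_inv (fun_of_lfun (linfun pop)^-1%VF).

Section OneWeight.
Variables (a : W r k) (th : 'Hom(T, tp)) (xi : 'Hom(tp, T)).
Hypothesis thK : cancel th xi.
Hypothesis th_xi : forall t, th (xi t) = pop (sym K a) t.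
Hypothesis thS : forall s x, th (rho s x) = tpow_mx (perm_mx s) (th x).

Lemma xi_rho s t : xi (tpow_mx (perm_mx s) t) = rho s (xi t).
Proof.
by apply: (can_inj thK); rewrite th_xi thS th_xi pop_equivariant.
Qed.

(** An endomorphism [f] becomes the operator [th f xi] on the tensor power. It is equivariant, hence
    comes from the partition algebra, and is unchanged by [s_a] on either side; [xi y th] goes
    back. *)
Lemma EndS_corner : alg_iso (EndS rho) (corner_alg K n a).
Proof.
have th_sym x : pop (sym K a) (th x) = th x by rewrite -th_xi thK.
have xi_sym t : xi (pop (sym K a) t) = xi t by rewrite -th_xi thK.
have conjS f : carrier (EndS rho) f -> equivariant (lconj th xi f).
  by move=> fS s t; rewrite !lconjE xi_rho fS thS.
pose F := pop_inv \o lconj th xi.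
apply: (@alg_iso_can _ (EndS rho) (corner_alg K n a) F (lconj xi th \o pop)) => /=.
- move=> f fS; apply/corner_popP => // t.
  by rewrite /F /= pop_invK; [rewrite !lconjE th_sym xi_sym|exact: conjS].
- by move=> y _ s x; rewrite !lconjE thS pop_equivariant xi_rho.
- move=> f fS; rewrite /F /= pop_invK; last exact: conjS.
  by apply/lfunP => x; rewrite !lconjE !thK.
- move=> y /corner_popP yE; rewrite -[RHS]popK /F /=; congr pop_inv.
  by apply/lfunP => t; rewrite !lconjE !th_xi yE.
- move=> f g fS gS; apply: (pop_inj n_ge2r).
  have fgS : carrier (EndS rho) (f \o g)%VF.
    by move=> s x; rewrite !comp_lfunE gS fS.
  rewrite pop_mul // /F /= !pop_invK; [|exact: conjS..].
  by apply/lfunP => t; rewrite !(comp_lfunE, lconjE) thK.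
- by rewrite -[RHS]popK /F /=; congr pop_inv; apply/lfunP => t;
    rewrite lconjE id_lfunE th_xi.
Qed.

End OneWeight.

(** * Block matrices over all weights *)

Section AllWeights.
Variables (th : W r k -> 'Hom(T, tp)) (xi : W r k -> 'Hom(tp, T)).
Hypothesis xi_th : forall x, \sum_a xi a (th a x) = x.
Hypothesis th_xi : forall a t, th a (xi a t) = pop (sym K a) t.
Hypothesis th_xi0 : forall a b t, a != b -> th a (xi b t) = 0.
Hypothesis thS : forall a s x, th a (rho s x) = tpow_mx (perm_mx s) (th a x).

Lemma tpow_perm_sum (I : finType) (s : 'S_n) (t : I -> tp) :
  tpow_mx (perm_mx s) (\sum_u t u) = \sum_u tpow_mx (perm_mx s) (t u).
Proof.
by apply/ffunP => i; rewrite tpow_permE !sum_ffunE; apply: eq_bigr => u _; rewrite tpow_permE.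
Qed.

Lemma tpow_perm0 (s : 'S_n) : tpow_mx (perm_mx s) 0 = 0 :> tp.
Proof. by apply/ffunP => i; rewrite tpow_permE !ffunE. Qed.

(** By [xi_th] a vector is determined by its components [th b], and these are compared one weight at
    a time. *)
Lemma xi_rho_weight a s t : xi a (tpow_mx (perm_mx s) t) = rho s (xi a t).
Proof.
rewrite -[LHS]xi_th -[RHS]xi_th; apply: eq_bigr => b _; congr (xi b _).
rewrite thS; have [->|ba] := eqVneq b a; first by rewrite !th_xi pop_equivariant.
by rewrite !th_xi0 // tpow_perm0.
Qed.

(** The block matrix of [f] for the decomposition of [T] into the images of the [xi a]. *)
Definition painted_of_end (f : 'End(T)) : painted_space K r k :=
  [ffun u => pop_inv (lconj (th u.1) (xi u.2) f)].

Lemma painted_of_end_linear : linear painted_of_end.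
Proof. by move=> c f g; apply/ffunP => u; rewrite !ffunE !linearP. Qed.
HB.instance Definition _ := GRing.isLinear.Build K 'End(T) (painted_space K r k) _
  painted_of_end painted_of_end_linear.

Definition end_of_painted (x : painted_space K r k) : 'End(T) :=
  \sum_u lconj (xi u.1) (th u.2) (pop (x u)).

Lemma end_of_paintedE x v : end_of_painted x v =
  \sum_a xi a (\sum_b pop (x (a, b)) (th b v)).
Proof.
rewrite /end_of_painted sum_lfunE; under [RHS]eq_bigr do rewrite linear_sum.
by rewrite pair_bigA; apply: eq_bigr => -[a b] _; rewrite lconjE.
Qed.

Lemma th_xi_sum a (u : W r k -> tp) :
  th a (\sum_b xi b (u b)) = pop (sym K a) (u a).
Proof.
rewrite linear_sum (bigD1 a) //= th_xi big1 ?addr0 // => b ba.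
by rewrite th_xi0 // eq_sym.
Qed.

(** The painted product is matrix multiplication with rows and columns indexed by weights. *)
Lemma painted_mulE (x y : painted_space K r k) a d :
  painted_mul n x y (a, d) = \sum_b pmul n (x (a, b)) (y (b, d)).
Proof.
rewrite /painted_mul sum_ffunE (bigD1 a) //= [X in _ + X]big1 ?addr0 => [|a' ne].
  rewrite sum_ffunE; apply: eq_bigr => b _; rewrite sum_ffunE (bigD1 b) //=.
  rewrite [X in _ + X]big1 ?addr0 => [|c cb].
    rewrite sum_ffunE (bigD1 d) //= eqxx ffunE eqxx big1 ?addr0 // => d' ne.
    by rewrite ffunE -pair_eqE /= eqxx eq_sym (negbTE ne).
  by rewrite sum_ffunE big1 // => d' _; rewrite eq_sym (negbTE cb) ffunE.
rewrite sum_ffunE big1 // => b _; rewrite sum_ffunE big1 // => c _.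
rewrite sum_ffunE big1 // => d' _; case: ifP => _; rewrite ffunE //.
by rewrite -pair_eqE /= eq_sym (negbTE ne).
Qed.

Lemma painted_oneE a b : painted_one K r k (a, b) = if a == b then sym K a else 0.
Proof.
rewrite /painted_one sum_ffunE (bigD1 a) //= ffunE -pair_eqE /= eqxx /= eq_sym.
rewrite big1 ?addr0 // => c ca; rewrite ffunE -pair_eqE /= eq_sym (negbTE ca) //.
Qed.

Lemma EndS_painted : alg_iso (EndS rho) (painted_alg K r n k).
Proof.
have th_sym a x : pop (sym K a) (th a x) = th a x.
  by rewrite -(th_xi_sum a (fun b => th b x)) xi_th.
have xi_sym a t : xi a (pop (sym K a) t) = xi a t.
  rewrite -[LHS]xi_th -[RHS]xi_th; apply: eq_bigr => b _; congr (xi b _).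
  have [->|ba] := eqVneq b a; first by rewrite !th_xi pop_sym_sym.
  by rewrite !th_xi0.
have conjS f a b : carrier (EndS rho) f -> equivariant (lconj (th a) (xi b) f).
  by move=> fS s t; rewrite !lconjE xi_rho_weight fS thS.
have popF f a b : carrier (EndS rho) f ->
    pop (painted_of_end f (a, b)) = lconj (th a) (xi b) f.
  by move=> fS; rewrite ffunE pop_invK //; exact: conjS.
apply: (@alg_iso_can _ (EndS rho) (painted_alg K r n k) painted_of_end end_of_painted) => /=.
- move=> f fS a b; apply/corner_popP => // t.
  by rewrite popF // !lconjE th_sym xi_sym.
- move=> x _ s v; rewrite -[RHS]xi_th end_of_paintedE; apply: eq_bigr => a _.
  rewrite thS end_of_paintedE th_xi_sum -[LHS]xi_sym -pop_equivariant tpow_perm_sum.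
  by congr (xi a (pop _ _)); apply: eq_bigr => b _; rewrite thS pop_equivariant.
- move=> f fS; apply/lfunP => v; rewrite end_of_paintedE -[RHS]xi_th.
  apply: eq_bigr => a _; congr (xi a _); rewrite -[in RHS](xi_th v) !linear_sum /=.
  by apply: eq_bigr => b _; rewrite popF // lconjE.
- move=> y yP; apply/ffunP => -[a b]; rewrite ffunE -[RHS]popK; congr pop_inv.
  apply/lfunP => t; rewrite lconjE end_of_paintedE th_xi_sum (bigD1 b) //= th_xi.
  rewrite big1 ?addr0 => [|c cb]; last by rewrite th_xi0 // linear0.
  by have /corner_popP-> := yP a b.
- move=> f g fS gS; apply/ffunP => -[a d]; apply: (pop_inj n_ge2r).
  have fgS : carrier (EndS rho) (f \o g)%VF.
    by move=> s x; rewrite !comp_lfunE gS fS.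
  rewrite popF // painted_mulE linear_sum; apply/lfunP => t.
  rewrite lconjE comp_lfunE -(xi_th (g _)) !linear_sum sum_lfunE.
  apply: eq_bigr => b _; rewrite /= pop_mul // comp_lfunE.
  by rewrite !popF // !lconjE.
- apply/ffunP => -[a b]; apply: (pop_inj n_ge2r); apply/lfunP => t.
  rewrite popF; last by move=> s x; rewrite !id_lfunE.
  rewrite lconjE id_lfunE painted_oneE; case: eqVneq => [->|ab]; first exact: th_xi.
  by rewrite th_xi0 // linear0 zero_lfunE.
Qed.

End AllWeights.
End CornerIso.

(** * Coordinates indexed by words *)
Section DualBasis.
Variables (K : numFieldType) (T : vectType K) (X : finType).
Variables (ka : X -> {scalar T}) (e : X -> T).

(** A basis given with its coordinate functionals, used both for monomials and for tensor products
    of monomials. *)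
Definition dual_basis :=
  (forall x y, ka x (e y) = (x == y)%:R) /\ (forall t, t = \sum_x ka x t *: e x).

End DualBasis.

Section WordCoordinates.
Variables (K : numFieldType) (r n k : nat).
Notation word := {ffun 'I_r -> 'I_n}.
Notation tp := (tpow K r n).
Notation pop := (@palg_op K r n).
Variables (T : vectType K) (X : finType) (ka : X -> {scalar T}) (e : X -> T).

Section Maps.
Variable c : word -> X.

Definition word_coord (t : T) : tp := [ffun i => ka (c i) t].

Lemma word_coord_linear : linear word_coord.
Proof. by move=> a t u; apply/ffunP => i; rewrite !ffunE linearP. Qed.
HB.instance Definition _ := GRing.isLinear.Build K T tp _ word_coord word_coord_linear.

(** Dividing by the number of words in the class of [i] makes each basis vector count once, so that
    this map undoes [word_coord] on the span of the [e (c i)]. *)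
Definition word_sum (u : tp) : T := \sum_i (u i / #|[set j | c j == c i]|%:R) *: e (c i).

Lemma word_sum_linear : linear word_sum.
Proof.
move=> a u v; rewrite /word_sum scaler_sumr -big_split /=; apply: eq_bigr => i _.
by rewrite scalerA -scalerDl mulrA -mulrDl !ffunE.
Qed.
HB.instance Definition _ := GRing.isLinear.Build K tp T _ word_sum word_sum_linear.

Lemma card_class_neq0 i : #|[set j | c j == c i]|%:R != 0 :> K.
Proof. by rewrite pnatr_eq0 -lt0n; apply/card_gt0P; exists i; rewrite inE. Qed.

End Maps.

Hypothesis dual : dual_basis ka e.

Lemma word_sum_coord c t : word_sum c (word_coord c t) =
  \sum_(x | [exists i, c i == x]) ka x t *: e x.
Proof.
rewrite /word_sum (partition_big c (fun x => [exists i, c i == x])) /=; last first.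
  by move=> i _; apply/existsP; exists i.
apply: eq_bigr => x /existsP[i /eqP ix].
under eq_bigr => j /eqP jx do rewrite ffunE jx.
rewrite -scaler_suml -[in RHS](divfK (card_class_neq0 c i) (ka x t)) ix mulr_natr.
by rewrite sumr_const cardsE.
Qed.

Lemma word_coord_sum0 c c' u : (forall i j, c i != c' j) ->
  word_coord c (word_sum c' u) = 0.
Proof.
move=> cc'; apply/ffunP => i; rewrite !ffunE linear_sum big1 // => j _.
by rewrite linearZ /= dual.1 (negbTE (cc' i j)) mulr0.
Qed.

(* Averaging over the words of the same content is averaging over the Young
   subgroup: the former average absorbs the latter on both sides. *)
Lemma word_coord_sum (a : W r k) c u :
  (forall i j, c i = c j <-> exists2 s, s \in young a & i = word_act j s) ->
  word_coord c (word_sum c u) = pop (sym K a) u.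
Proof.
move=> cY.
have c_word_act i s : s \in young a -> c (word_act i s) = c i by move=> sY; apply/cY; exists s.
pose N i : K := #|[set j | c j == c i]|%:R.
have avgE v i : word_coord c (word_sum c v) i = (N i)^-1 * \sum_(j | c j == c i) v j.
  rewrite ffunE linear_sum mulr_sumr [RHS]big_mkcond; apply: eq_bigr => j _.
  rewrite linearZ /= dual.1 eq_sym; case: eqP => [ji|_]; last by rewrite mulr0.
  by rewrite mulr1 /N ji mulrC.
transitivity (word_coord c (word_sum c (pop (sym K a) u))).
  apply/ffunP => i; rewrite !avgE; congr (_ * _).
  under [RHS]eq_bigr do rewrite pop_symE.
  rewrite -mulr_sumr exchange_big /=.
  transitivity (#|young a|%:R^-1 * \sum_(s in young a) \sum_(j | c j == c i) u j).
    by rewrite [in RHS]sumr_const -[X in _ = _ * X]mulr_natl mulKf // card_young_neq0.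
  congr (_ * _); apply: eq_bigr => s sY.
  rewrite (reindex (fun j => word_act j s)) /=; last first.
    by exists (fun j => word_act j s^-1%g) => j _; rewrite ?word_actK ?word_actKV.
  by apply: eq_bigl => j; rewrite c_word_act.
apply/ffunP => i; rewrite avgE.
have -> : \sum_(j | c j == c i) pop (sym K a) u j = pop (sym K a) u i *+ #|[set j | c j == c i]|.
  rewrite cardsE -sumr_const; apply: eq_bigr => j /eqP/cY[s sY ->].
  exact: pop_sym_invariant.
by rewrite -[_ *+ _]mulr_natl mulKf // card_class_neq0.
Qed.

End WordCoordinates.

(** * Coefficients of homogeneous polynomials *)

Section PolyfunCoordinates.
Variables (K : numFieldType) (n m d : nat).
Notation mono := (mono n m d).
Notation poly := (polyfun K n m d).

Lemma polyfun_hpoly (f : poly) : is_hpoly d f.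
Proof. by case: f => f fP; have /asboolP := fP. Qed.

(** A chosen expansion; its uniqueness, from [mono_free], is what makes the coefficient linear in
    [f]. *)
Definition pcoef (e : mono) (f : poly) : K := projT1 (cid (polyfun_hpoly f)) e.

Lemma pcoefE (f : poly) v : f v = \sum_e pcoef e f * mono_fun e v.
Proof. exact: (projT2 (cid (polyfun_hpoly f))). Qed.

Lemma pcoef_uniq (f : poly) (c : mono -> K) :
  (forall v, f v = \sum_e c e * mono_fun e v) -> forall e, pcoef e f = c e.
Proof.
move=> fc e; apply/eqP; rewrite -subr_eq0; apply/eqP; move: e; apply: mono_free => v.
by under eq_bigr do rewrite mulrBl; rewrite sumrB -pcoefE -fc subrr.
Qed.

Lemma pcoef_scalar e : scalar (pcoef e).
Proof.
move=> c f g; apply: (pcoef_uniq (c := fun e => c * pcoef e f + pcoef e g)) => v.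
transitivity (c * f v + g v) => //; rewrite !pcoefE mulr_sumr -big_split /=.
by apply: eq_bigr => e' _; rewrite mulrDl mulrA.
Qed.
HB.instance Definition _ e :=
  GRing.isLinear.Build K poly K *%R (pcoef e) (pcoef_scalar e).

Lemma mono_hpoly (e : mono) : (mono_fun e : 'M[K]_(n, m) -> K^o) \in hpoly d.
Proof.
apply/asboolP; exists (fun e' => (e' == e)%:R) => v.
by rewrite (bigD1 e) //= eqxx mul1r big1 ?addr0 // => e' /negbTE->; rewrite mul0r.
Qed.

Definition pmono e : poly := PolyFun (mono_hpoly e).

Lemma polyfun_dual_basis : dual_basis (fun e => pcoef e : {scalar poly}) pmono.
Proof.
have coef e e' : pcoef e (pmono e') = (e == e')%:R.
  apply: (pcoef_uniq (c := fun e => (e == e')%:R)) => v /=.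
  by rewrite (bigD1 e') //= eqxx mul1r big1 ?addr0 // => u /negbTE->; rewrite mul0r.
split=> // f; apply: val_inj; apply/funext => v /=.
rewrite !pcoefE; apply: eq_bigr => e _; congr (_ * _).
rewrite linear_sum (bigD1 e) //= big1 => [|e' /negbTE ee']; rewrite linearZ /= coef.
  by rewrite eqxx mulr1 addr0.
by rewrite eq_sym ee' mulr0.
Qed.

Lemma mono_of_proof (g : 'I_n * 'I_m -> nat) : (\sum_x g x = d)%N ->
  (\sum_x [ffun x => inord (g x) : 'I_d.+1] x == d)%N.
Proof.
move=> gd; rewrite -[X in _ == X]gd; apply/eqP/eq_bigr => x _.
by rewrite ffunE inordK // ltnS -gd (bigD1 x) //= leq_addr.
Qed.

(** Exponents with sum [d] are at most [d], so [inord] preserves their values. *)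
Definition mono_of g (gd : (\sum_x g x = d)%N) : mono :=
  Sub [ffun x => inord (g x)] (mono_of_proof gd).

Lemma mono_ofE g gd x : val (@mono_of g gd) x = g x :> nat.
Proof. by rewrite /= ffunE inordK // ltnS -gd (bigD1 x) //= leq_addr. Qed.

Lemma mono_ext (e e' : mono) : (forall x, val e x = val e' x :> nat) -> e = e'.
Proof. by move=> ee'; apply: val_inj; apply/ffunP => x; apply: val_inj; exact: ee'. Qed.

Lemma mono_act_proof (s : 'S_n) (e : mono) :
  (\sum_(x : 'I_n * 'I_m) val e (s x.1, x.2) = d)%N.
Proof.
rewrite -[RHS](eqP (valP e)) [RHS](reindex (fun x => (s x.1, x.2))) //=.
by exists (fun x => ((s^-1)%g x.1, x.2)) => -[i j] _ /=; rewrite ?permK ?permKV.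
Qed.

Definition mono_act s e : mono := mono_of (mono_act_proof s e).

Lemma mono_actE s e x : val (mono_act s e) x = val e (s x.1, x.2) :> nat.
Proof. exact: mono_ofE. Qed.

Lemma mono_actK s : cancel (mono_act s) (mono_act s^-1%g).
Proof. by move=> e; apply: mono_ext => -[i j]; rewrite !mono_actE /= permKV. Qed.

Lemma mono_actKV s : cancel (mono_act s^-1%g) (mono_act s).
Proof. by move=> e; apply: mono_ext => -[i j]; rewrite !mono_actE /= permK. Qed.

(** Substituting the permuted matrix into a monomial yields its image under [mono_act s]; reindexing
    the expansion moves the inverse onto the coefficients. *)
Lemma pcoef_polyact s (f : poly) e : pcoef e (polyact s f) = pcoef (mono_act s^-1%g e) f.
Proof.
apply: (pcoef_uniq (c := fun e => pcoef (mono_act s^-1%g e) f)) => v /=.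
rewrite pcoefE [RHS](reindex (mono_act s)) /=; last first.
  by exists (mono_act s^-1%g) => u _; rewrite ?mono_actK ?mono_actKV.
apply: eq_bigr => u _; rewrite mono_actK; congr (_ * _); rewrite /mono_fun.
have -> : invmx (perm_mx s) = perm_mx s^-1%g :> 'M[K]_n.
  have U : perm_mx s \in unitmx := unitmx_perm K s.
  by apply: (can_inj (mulKmx U)); rewrite mulmxV // -perm_mxM mulgV perm_mx1.
rewrite [LHS](reindex (fun x => (s x.1, x.2))) /=; last first.
  by exists (fun x => ((s^-1)%g x.1, x.2)) => -[i j] _ /=; rewrite ?permK ?permKV.
by apply: eq_bigr => -[i j] _; rewrite -row_permE !mxE mono_actE /= permK.
Qed.

End PolyfunCoordinates.

(** * Monomials attached to words *)

Section Content.
Variables (r n k : nat).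
Notation word := {ffun 'I_r -> 'I_n}.
Implicit Types (a b : W r k) (i j : word).

Definition wcount a i (x : 'I_n) (c : 'I_k) : nat :=
  #|[set l | (interval a l == c) && (i l == x)]|.

Lemma wcount_col a i c : (\sum_x wcount a i x c = part a c)%N.
Proof.
rewrite -card_interval -sum1_card (partition_big i predT) //=.
by apply: eq_bigr => x _; rewrite /wcount -sum1_card; apply: eq_bigl => l; rewrite !inE.
Qed.

Lemma wcount_total a i : (\sum_(x : 'I_n * 'I_k) wcount a i x.1 x.2 = r)%N.
Proof.
rewrite -(pair_bigA _ (fun x c => wcount a i x c)) exchange_big /= -[RHS](sum_part a).
by apply: eq_bigr => c _; exact: wcount_col.
Qed.

(** Equal counts mean equal fibres for the map sending a place to its interval and letter; a
    permutation matching these fibres preserves intervals, so it lies in the Young subgroup. *)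
Lemma wcountP a i j : (forall x c, wcount a i x c = wcount a j x c) <->
  exists2 s, s \in young a & i = word_act j s.
Proof.
split=> [H|[s /youngP sY ->] x c]; last first.
  rewrite /wcount -(card_imset _ (@perm_inj _ s)); apply: eq_card => l.
  rewrite inE; apply/imsetP/idP => [[l' /[!inE]]|H].
    by rewrite ffunE -(sY l') => H ->.
  by exists (s^-1%g l); rewrite ?permKV // inE ffunE permKV -(sY (_ l)) permKV.
have [s sE] : exists s : 'S_r, forall l, (interval a l, i l) = (interval a (s l), j (s l)).
  apply: (@perm_of_eq_fibers _ _ (fun l => (interval a l, i l))
           (fun l => (interval a l, j l))) => -[c x].
  have := H x c; rewrite /wcount => E.
  transitivity #|[set l | (interval a l == c) && (i l == x)]|.
    by apply: eq_card => l; rewrite !inE.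
  by rewrite E; apply: eq_card => l; rewrite !inE.
exists s; first by apply/youngP => l; exact: esym (congr1 fst (sE l)).
by apply/ffunP => l; rewrite ffunE; exact: (congr1 snd (sE l)).
Qed.

Lemma wcount_wperm a i (s : 'S_n) x c :
  wcount a [ffun l => s (i l)] x c = wcount a i (s^-1%g x) c.
Proof.
apply: eq_card => l; rewrite !inE ffunE; congr (_ && _).
by rewrite -(inj_eq (@perm_inj _ s) (i l)) permKV.
Qed.

Lemma exists_word a (m : 'I_n -> 'I_k -> nat) :
  (forall c, \sum_x m x c = part a c)%N -> exists i, forall x c, wcount a i x c = m x c.
Proof.
move=> ma; have [c|g gE] := @exists_fiber_split 'I_r 'I_k 'I_n (interval a) (fun c x => m x c).
  by rewrite card_interval.
exists (finfun g) => x c; rewrite -gE; apply: eq_card => l; rewrite !inE ffunE //.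
Qed.

(** The monomial that is the product over places [l] of the variables in row [i l] and column
    [interval a l]. *)
Definition content a i : mono n k r := mono_of (wcount_total a i).

Lemma contentE a i x c : val (content a i) (x, c) = wcount a i x c :> nat.
Proof. exact: mono_ofE. Qed.

Lemma contentP a i j : content a i = content a j <-> exists2 s, s \in young a & i = word_act j s.
Proof.
rewrite -wcountP; split=> [ij x c|ij]; first by rewrite -!contentE ij.
by apply: mono_ext => -[x c]; rewrite !contentE.
Qed.

(** The degree of the monomial in the variables of column [c] is [part a c], so the monomial
    determines the weight. *)
Lemma content_neq a b i j : a != b -> content a i != content b j.
Proof.
apply: contraNneq => ij; apply/eqP/W_ext => c; rewrite -(wcount_col a i) -(wcount_col b j).
by apply: eq_bigr => x _; rewrite -!contentE ij.
Qed.

Lemma content_surj (e : mono n k r) : exists a i, content a i = e.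
Proof.
have [a aE] : exists a : W r k, forall c, part a c = (\sum_x val e (x, c))%N.
  apply: W_exists; rewrite exchange_big pair_bigA -[RHS](eqP (valP e)).
  by apply: eq_bigr => -[].
have [i iE] := @exists_word a (fun x c => val e (x, c)) (fun c => esym (aE c)).
by exists a, i; apply: mono_ext => -[x c]; rewrite contentE.
Qed.

Lemma content_wperm a i (s : 'S_n) :
  mono_act s^-1%g (content a i) = content a [ffun l => s (i l)].
Proof. by apply: mono_ext => -[x c]; rewrite mono_actE !contentE wcount_wperm. Qed.

Lemma wcount_row a i c : (\sum_(x : 'I_n * 'I_1) wcount a i x.1 c = part a c)%N.
Proof.
rewrite -(pair_bigA _ (fun x (_ : 'I_1) => wcount a i x c)) /= -[RHS](wcount_col a i).
by apply: eq_bigr => x _; rewrite big_ord1.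
Qed.

(** The same letter counts as in [content], split into one monomial per tensor factor. *)
Definition contents a i : fprod (fun c => mono n 1 (part a c)) :=
  [fprod c : 'I_k => mono_of (wcount_row a i c)].

Lemma contentsE a i c x : val (contents a i c) x = wcount a i x.1 c :> nat.
Proof. by rewrite /contents fprodE mono_ofE. Qed.

Lemma contentsP a i j : contents a i = contents a j <-> exists2 s, s \in young a & i = word_act j s.
Proof.
rewrite -wcountP; split=> [ij x c|ij].
  by rewrite -!(contentsE _ _ c (x, ord0)) ij.
by apply/fprodP => c; apply: mono_ext => x; rewrite !contentsE.
Qed.

Lemma contents_surj a (e : fprod (fun c => mono n 1 (part a c))) :
  exists i, contents a i = e.
Proof.
have [c|i iE] := @exists_word a (fun x c => val (e c) (x, ord0)).
  rewrite -[RHS](eqP (valP (e c))).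
  transitivity (\sum_x \sum_(y < 1) val (e c) (x, y))%N.
    by apply: eq_bigr => x _; rewrite big_ord1.
  by rewrite pair_bigA; apply: eq_bigr => -[].
exists i; apply/fprodP => c; apply: mono_ext => -[x y].
by rewrite contentsE iE /= (ord1 y).
Qed.

Lemma contents_wperm a i (s : 'S_n) c :
  mono_act s^-1%g (contents a i c) = contents a [ffun l => s (i l)] c.
Proof. by apply: mono_ext => x; rewrite mono_actE !contentsE wcount_wperm. Qed.

End Content.

(** * The two isomorphisms *)
Lemma prod_sum_fprod (K : comPzRingType) (I : finType) (X : I -> finType)
    (F : forall i, X i -> K) :
  \prod_i \sum_x F i x = \sum_(g : fprod X) \prod_i F i (g i).
Proof.
pose G i := [ffun x : X i => F i x].
transitivity (\sum_(g : fprod X) \prod_(i in I) G i (g i)).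
  rewrite (big_fprod _ _ G) -(bigA_distr_big_dep _ (fun i => untag 0 (G i))) /=.
  apply: eq_bigr => i _; rewrite -(big_tag (fun i => G i)) /=.
  by apply: eq_bigr => x _; rewrite ffunE.
by apply: eq_bigr => g _; apply: eq_bigr => i _; rewrite ffunE.
Qed.

(** * Dual bases of tensor products *)

Section TensorDualBasis.
Variables (K : numFieldType) (k : nat) (U : 'I_k -> vectType K).
Variables (X : 'I_k -> finType).
Variables (ka : forall j, X j -> {scalar U j}) (e : forall j, X j -> U j).

(** The tensor product of the functionals [ka (x j)], written in the coordinates of [tensor]. *)
Definition tensor_coord (x : fprod X) (t : tensor U) : K :=
  \sum_(J : tindex U) t J * \prod_j ka (x j) (vbasis {: U j})`_(J j).

Lemma tensor_coord_scalar x : scalar (tensor_coord x).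
Proof.
move=> c t u; rewrite /tensor_coord mulr_sumr -big_split; apply: eq_bigr => J _.
by rewrite /= ffunE ffun_scaleE mulrA -mulrDl.
Qed.
HB.instance Definition _ x :=
  GRing.isLinear.Build K (tensor U) K *%R (tensor_coord x) (tensor_coord_scalar x).

Lemma tensor_coord_pure x (u : forall j, U j) :
  tensor_coord x (tpure u) = \prod_j ka (x j) (u j).
Proof.
transitivity (\prod_j \sum_(l < \dim {: U j})
    coord (vbasis {: U j}) l (u j) * ka (x j) (vbasis {: U j})`_l); last first.
  apply: eq_bigr => j _; rewrite [in RHS](coord_vbasis (memvf (u j))) linear_sum.
  by apply: eq_bigr => l _; rewrite linearZ.
rewrite (@prod_sum_fprod _ _ (fun j => 'I_(\dim {: U j}))
  (fun j l => coord (vbasis {: U j}) l (u j) * ka (x j) (vbasis {: U j})`_l)).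
by apply: eq_bigr => J _; rewrite ffunE big_split.
Qed.

Hypothesis dual : forall j, dual_basis (@ka j) (@e j).

Lemma tensor_dual_basis : dual_basis (fun x => tensor_coord x : {scalar tensor U})
  (fun x : fprod X => tpure (fun j => e (x j))).
Proof.
split=> [x y|t].
  rewrite /= tensor_coord_pure; have [->|xy] := eqVneq x y.
    by rewrite big1 // => j _; rewrite (dual j).1 eqxx.
  have [j xyj] : exists j, x j != y j.
    apply/existsP; apply: contraNT xy => /existsPn H; apply/eqP/fprodP => j.
    by apply/eqP/negPn.
  by rewrite (bigD1 j) //= (dual j).1 (negbTE xyj) mul0r.
apply/ffunP => L; rewrite sum_ffunE.
(* Expanding the vectors of [vbasis] in the basis [e] shows that each inner sum is a Kronecker
   delta, so only [J = L] remains. *)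
transitivity (\sum_(J : tindex U) t J * \prod_j \sum_(x : X j)
    (ka x (vbasis {: U j})`_(J j) * coord (vbasis {: U j}) (L j) (e x))).
  rewrite (bigD1 L) //= [X in _ = _ + X]big1 => [|J JL].
    rewrite addr0 big1 ?mulr1 // => j _.
    rewrite -[RHS](_ : coord (vbasis {: U j}) (L j) (vbasis {: U j})`_(L j) = 1); last first.
      by rewrite (coord_free _ _ (basis_free (vbasisP _))) eqxx.
    rewrite [in RHS]((dual j).2 (vbasis {: U j})`_(L j)) linear_sum.
    by apply: eq_bigr => x _; rewrite linearZ.
  have [j Jj] : exists j, J j != L j.
    apply/existsP; apply: contraNT JL => /existsPn H; apply/eqP/fprodP => j.
    by apply/eqP/negPn.
  rewrite (bigD1 j) //= (_ : \sum_x _ = 0) ?mul0r ?mulr0 //.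
  transitivity (coord (vbasis {: U j}) (L j) (vbasis {: U j})`_(J j)).
    rewrite [in RHS]((dual j).2 (vbasis {: U j})`_(J j)) linear_sum.
    by apply: eq_bigr => x _; rewrite linearZ.
  by rewrite (coord_free _ _ (basis_free (vbasisP _))) (negbTE Jj).
under eq_bigr do rewrite prod_sum_fprod mulr_sumr.
rewrite exchange_big; apply: eq_bigr => x _ /=.
rewrite ffun_scaleE ffunE /tensor_coord mulr_suml; apply: eq_bigr => J _.
by rewrite big_split mulrA.
Qed.

Lemma tensor_coord_tmap (x y : fprod X) (f : forall j, U j -> U j) t :
  (forall j u, ka (x j) (f j u) = ka (y j) u) ->
  tensor_coord x (tmap f t) = tensor_coord y t.
Proof.
move=> fxy; rewrite /tmap linear_sum; apply: eq_bigr => J _.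
by rewrite linearZ /= tensor_coord_pure; congr (_ * _); apply: eq_bigr => j _.
Qed.

End TensorDualBasis.

(** * Realisation of the modules inside the tensor power *)

Section Isomorphisms.
Variables (K : numFieldType) (r n k : nat).
Hypotheses (n_gt0 : (0 < n)%N) (n_ge2r : (2 * r <= n)%N).
Notation tp := (tpow K r n).
Notation pop := (@palg_op K r n).
Implicit Types a : W r k.

Section Sym.
Variable a : W r k.

Lemma sVP (t : tp) : reflect (pop (sym K a) t = t) (t \in sV K n a).
Proof.
apply: (iffP memv_imgP) => [[u _ ->]|<-].
  by rewrite lfunE /= -popE pop_sym_sym.
by exists t; rewrite ?memvf // lfunE popE.
Qed.

Definition sV_in : 'Hom(subvs_of (sV K n a), tp) := linfun vsval.
(** Applying [s_a] first ensures that [vsproj] only meets vectors of the subspace, where it inverts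
    the inclusion. *)
Definition sV_out : 'Hom(tp, subvs_of (sV K n a)) := (linfun (vsproj (sV K n a)) \o pop (sym K a))%VF.

Lemma sV_inK : cancel sV_in sV_out.
Proof.
move=> x; rewrite comp_lfunE !lfunE /=; have /sVP-> := subvsP x; exact: vsvalK.
Qed.

Lemma sV_in_out t : sV_in (sV_out t) = pop (sym K a) t.
Proof. by rewrite comp_lfunE !lfunE /= vsprojK //; apply/sVP; exact: pop_sym_sym. Qed.

Lemma sV_in_act s x : sV_in (sV_act s x) = tpow_mx (perm_mx s) (sV_in x).
Proof. by rewrite !lfunE /= vsprojK //; exact: sV_perm. Qed.

End Sym.

Notation TP a := (tensor (fun j => polyfun K n 1 (part a j))).

Section Tensor.
Variable a : W r k.

Definition tens_coord (x : fprod (fun j => mono n 1 (part a j))) : {scalar TP a} :=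
  tensor_coord (fun j (e : mono n 1 (part a j)) => pcoef e : {scalar polyfun K n 1 (part a j)}) x.

Definition tens_mono (x : fprod (fun j => mono n 1 (part a j))) : TP a :=
  tpure (fun j => pmono K (x j)).

Lemma tens_dual : dual_basis tens_coord tens_mono.
Proof.
have H := @tensor_dual_basis K k (fun j => polyfun K n 1 (part a j))
  (fun j => mono n 1 (part a j)) (fun j e => pcoef e) (fun j e => pmono K e)
  (fun j => @polyfun_dual_basis K n 1 (part a j)).
exact: H.
Qed.

Definition tens_in : 'Hom(TP a, tp) := linfun (word_coord tens_coord (contents a)).
Definition tens_out : 'Hom(tp, TP a) := linfun (word_sum tens_mono (contents a)).

Lemma tens_inK : cancel tens_in tens_out.
Proof.
move=> t; rewrite !lfunE /= word_sum_coord [RHS](tens_dual.2 t).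
by apply: eq_bigl => x; have [i <-] := contents_surj x; apply/existsP; exists i.
Qed.

Lemma tens_in_out t : tens_in (tens_out t) = pop (sym K a) t.
Proof. by rewrite !lfunE; apply: (word_coord_sum tens_dual) => i j; exact: contentsP. Qed.

Lemma tens_in_act s x :
  tens_in (tmap (fun j => @polyact K n 1 (part a j) s) x) = tpow_mx (perm_mx s) (tens_in x).
Proof.
rewrite !lfunE; apply/ffunP => i; rewrite tpow_permE !ffunE.
by apply: tensor_coord_tmap => j u; rewrite /= pcoef_polyact contents_wperm.
Qed.

Lemma MPa_EndsV : alg_iso (MPa K n a) (EndsV K n a).
Proof.
exact: (EndS_sym_iso tens_inK tens_in_out tens_in_act
  (@sV_inK a) (@sV_in_out a) (@sV_in_act a)).
Qed.

End Tensor.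

Lemma EndsV_corner a : alg_iso (EndsV K n a) (corner_alg K n a).
Proof. exact: (EndS_corner n_gt0 n_ge2r (@sV_inK a) (@sV_in_out a) (@sV_in_act a)). Qed.

Definition poly_coord (e : mono n k r) : {scalar polyfun K n k r} := pcoef e.
Definition poly_in a : 'Hom(polyfun K n k r, tp) := linfun (word_coord poly_coord (content a)).
Definition poly_out a : 'Hom(tp, polyfun K n k r) :=
  linfun (word_sum (@pmono K n k r) (content a)).

Lemma MP_painted : alg_iso (MP K r n k) (painted_alg K r n k).
Proof.
have dual : dual_basis poly_coord (@pmono K n k r) := @polyfun_dual_basis K n k r.
apply: (@EndS_painted _ _ _ _ n_gt0 n_ge2r _ _ poly_in poly_out).
- move=> x; under eq_bigr do rewrite !lfunE /= word_sum_coord.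
  rewrite (exchange_big_dep predT) //= [RHS](dual.2 x); apply: eq_bigr => e _.
  (* Each monomial has exactly one weight, given by its column degrees, so it is recovered from a
     single summand. *)
  have [a [i ie]] := content_surj e; rewrite (big_pred1 a) // => b /=.
  apply/existsP/eqP => [[j /eqP je]|->]; last by exists i; rewrite ie.
  by apply/eqP/negPn/negP => ba; have := content_neq j i ba; rewrite je ie eqxx.
- by move=> a t; rewrite !lfunE; apply: (word_coord_sum dual) => i j; exact: contentP.
- move=> a b t ab; rewrite !lfunE; apply: (word_coord_sum0 dual) => i j.
  exact: content_neq.
move=> a s x; rewrite !lfunE; apply/ffunP => i; rewrite tpow_permE !ffunE.
by rewrite /poly_coord /= pcoef_polyact content_wperm.
Qed.

End Isomorphisms.

Theorem mainTheorem3 (R : realType) (r k n : nat)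
    (hr : (0 < r)%N) (hk : (0 < k)%N) (hn : (2 * r <= n)%N) (a : W r k) :
  (* MP_a(n) and End_{S_n}(s_a V_n^{\otimes r}) and s_a P_r(n) s_a *)
  alg_iso (MPa R[i] n a) (EndsV R[i] n a) /\
  alg_iso (EndsV R[i] n a) (corner_alg R[i] n a) /\
  (* s_a P_r(n) s_a as a span in the painted algebra *)
  [set painted_inj a a x | x in corner (K := R[i]) n a a]%classic =
    lspan [set D R[i] r n pt | pt in
             [set pt | @msPi r k pt /\ has_mult pt a a]]%classic /\
  (* the D_{pt} do not depend on the choice of a representative, and form a
     basis of the painted algebra, which is isomorphic to MP_{r,k}(n) *)
  (forall (b c : W r k) (p : diag r),
     D R[i] r n (kappa b c p) =
     painted_inj b c (pmul n (pmul n (sym R[i] b) (L R[i] p)) (sym R[i] c))) /\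
  lspan [set D R[i] r n pt | pt in @msPi r k]%classic = painted (k := k) n /\
  lfree (@msPi r k) (fun pt : mspartition k => D R[i] r n pt) /\
  alg_iso (MP R[i] r n k) (painted_alg R[i] r n k).
Proof.
have n_gt0 : (0 < n)%N by apply: leq_trans hn; rewrite muln_gt0.
split; first exact: MPa_EndsV.
split; first exact: EndsV_corner.
split; first exact: corner_lspan.
split; first exact: D_kappa.
split; first exact: painted_lspan.
split; [exact: D_lfree|exact: MP_painted].
Qed.
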